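(* For every left semistrict rig category $\mathbb{S}$, with underlying category $\mathcal{S}$, the set of objects of $\mathcal{H}om_{\mathbf{RigCat}}(\widehat{\mathbb{F}\mathbb{S}et}_{sk},\mathbb{S})$ is in bijection with the set of pairs $(x,\tau)$, with $x=(x_n)_{n\ge0}$ any sequence of objects of $\mathcal{S}$ such that $x_n\cong\underline{n}$ for each $n\ge0$, and $\tau=(\tau_n)_{n\ge0}$ any sequence of isomorphisms $\tau_n:x_n\to\underline{n}$. In particular, if $\mathbb{S}$ is skeletal, $\mathcal{H}om_{\mathbf{RigCat}}(\widehat{\mathbb{F}\mathbb{S}et}_{sk},\mathbb{S})$ is isomorphic to the contractible category with set of objects $\prod_{n\ge0}Aut_{\mathcal{S}}(\underline{n})$.
   Context: Composition is written by juxtaposition ($gf$ means $f$ followed by $g$); $xy$ abbreviates $x\bullet y$ on objects. **Rig category.** A rig category $\mathbb{S}$ is a category $\mathcal{S}$ with a symmetric monoidal structure $(+,0,a,c,l,r)$, $a_{x,y,z}:x+(y+z)\to(x+y)+z$, a second monoidal structure $(\bullet,1,a',l',r')$, $a'_{x,y,z}:x(yz)\to(xy)z$, and natural isomorphisms $d_{x,y,z}:x(y+z)\to xy+xz$, $d'_{x,y,z}:(x+y)z\to xz+yz$, $n_x:x0\to0$, $n'_x:0x\to0$ such that for all objects $x,y,z,t$: (1) $(d_{x,y,z}+id_{xt})\,d_{x,y+z,t}\,(id_x\bullet a_{y,z,t})=a_{xy,xz,xt}\,(id_{xy}+d_{x,z,t})\,d_{x,y,z+t}$ and $(d'_{x,y,t}+id_{zt})\,d'_{x+y,z,t}\,(a_{x,y,z}\bullet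 id_t)=a_{xt,yt,zt}\,(id_{xt}+d'_{y,z,t})\,d'_{x,y+z,t}$; (2) $d_{x,z,y}(id_x\bullet c_{y,z})=c_{xy,xz}d_{x,y,z}$ and $d'_{z,y,x}(c_{y,z}\bullet id_x)=c_{yx,zx}d'_{y,z,x}$; (3) $l_{xy}(n_x+id_{xy})d_{x,0,y}=id_x\bullet l_y$ and $l_{xy}(n'_y+id_{xy})d'_{0,x,y}=l_x\bullet id_y$; (4) $r_{xy}(id_{xy}+n_x)d_{x,y,0}=id_x\bullet r_y$ and $r_{xy}(id_{xy}+n'_y)d'_{x,0,y}=r_x\bullet id_y$; (5) $(a'_{x,z,y}+a'_{x,t,y})d_{x,zy,ty}(id_x\bullet d'_{z,t,y})=d'_{xz,xt,y}(d_{x,z,t}\bullet id_y)a'_{x,z+t,y}$ and $n'_y(n_x\bullet id_y)a'_{x,0,y}=n_x(id_x\bullet n'_y)$; (6) $(a'_{x,y,z}+a'_{x,y,t})d_{x,yz,yt}(id_x\bullet d_{y,z,t})=d_{xy,z,t}a'_{x,y,z+t}$, $n_{xy}a'_{x,y,0}=n_x(id_x\bullet n_y)$, $d'_{ty,zy,x}(d'_{t,z,y}\bullet id_x)a'_{t+z,y,x}=(a'_{t,y,x}+a'_{z,y,x})d'_{t,z,yx}$, $n'_x(n'_y\bullet id_x)a'_{0,y,x}=n'_{yx}$; (7) $v_{xz,xt,yz,yt}(d_{x,z,t}+d_{y,z,t})d'_{x,y,z+t}=(d'_{x,y,z}+d'_{x,y,t})d_{x+y,z,t}$, where $v_{p,q,s,u}:(p+q)+(s+u)\to(p+s)+(q+u)$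 is the canonical isomorphism built from $a$ and $c$; $l_0(n_x+n_y)d'_{x,y,0}=n_{x+y}$; $l_0(n'_x+n'_y)d_{0,x,y}=n'_{x+y}$; (8) $(l'_x+l'_y)d_{1,x,y}=l'_{x+y}$, $(r'_x+r'_y)d'_{x,y,1}=r'_{x+y}$, $n_1=l'_0$, $n'_1=r'_0$; (9) $n_0=n'_0$. It is left semistrict if all structural isomorphisms except possibly $c$ and $d'$ are identities, and skeletal if isomorphic objects of $\mathcal{S}$ are equal. **Homomorphism.** A homomorphism of rig categories $\mathbb{F}=(F,\varphi^+,\varepsilon^+,\varphi^\bullet,\varepsilon^\bullet):\mathbb{S}\to\tilde{\mathbb{S}}$ is a functor $F:\mathcal{S}\to\tilde{\mathcal{S}}$ with natural isomorphisms $\varphi^+_{x,y}:F(x+y)\to Fx+Fy$ and an isomorphism $\varepsilon^+:F0\to\tilde0$ making $F$ a (strong) symmetric monoidal functor for the additive structures, and natural isomorphisms $\varphi^\bullet_{x,y}:F(xy)\to Fx\,Fy$ and an isomorphism $\varepsilon^\bullet:F1\to\tilde1$ making $F$ a (strong) monoidal functor for the multiplicative structures, such that for all $x,y,z$: $(\varphi^\bullet_{x,y}+\varphi^\bullet_{x,z})\varphi^+_{xy,xz}F(d_{x,y,z})=\tilde d_{Fx,Fy,Fz}(id_{Fx}\bullet\varphi^+_{y,z})\varphi^\bullet_{x,y+z}$; $(\varphi^\bullet_{y,x}+\varphi^\bullet_{z,x})\varphi^+_{yx,zx}F(d'_{y,z,x})=\tilde d'_{Fy,Fz,Fx}(\varphi^+_{y,z}\bullet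 id_{Fx})\varphi^\bullet_{y+z,x}$; $\varepsilon^+F(n_x)=\tilde n_{Fx}(id_{Fx}\bullet\varepsilon^+)\varphi^\bullet_{x,0}$; $\varepsilon^+F(n'_x)=\tilde n'_{Fx}(\varepsilon^+\bullet id_{Fx})\varphi^\bullet_{0,x}$. **Rig transformation.** A rig transformation $\mathbb{F}_1\Rightarrow\mathbb{F}_2$ is a natural transformation $F_1\Rightarrow F_2$ that is monoidal both for $+$ and for $\bullet$. Rig categories, homomorphisms and rig transformations form the 2-category $\mathbf{RigCat}$; $\mathcal{H}om_{\mathbf{RigCat}}(\mathbb{S}',\mathbb{S})$ is the category of homomorphisms $\mathbb{S}'\to\mathbb{S}$ and rig transformations between them. **The left semistrict 2-rig $\widehat{\mathbb{F}\mathbb{S}et}_{sk}$.** Its underlying groupoid $\widehat{\mathcal{F}\mathcal{S}et}_{sk}$ has objects $[n]=\{1,\dots,n\}$, $n\ge0$ ($[0]=\emptyset$), and morphisms the bijections, so $Aut([n])=S_n$. On objects $[m]+[n]=[m+n]$, $[m]\bullet[n]=[mn]$; zero object $[0]$, unit object $[1]$. For $f\in S_m$, $g\in S_n$: $(f+g)(k)=f(k)$ if $k\le m$, $(f+g)(m+k)=m+g(k)$ if $1\le k\le n$; $(f\bullet g)((j-1)m+i)=(g(j)-1)m+f(i)$ for $1\le i\le m$, $1\le j\le n$. The additive commutator is $c_{[m],[n]}(k)=n+k$ for $k\le m$, $c_{[m],[n]}(k)=k-m$ for $m<k\le m+n$. The right distributor $d'_{[m],[n],[p]}$ is the inverse of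 the permutation $\overline d'$ of $[(m+n)p]$ given by $\overline d'((j-1)m+i)=(j-1)(m+n)+i$ ($1\le i\le m$, $1\le j\le p$) and $\overline d'(mp+(j-1)n+i)=(j-1)(m+n)+m+i$ ($1\le i\le n$, $1\le j\le p$). All other structural isomorphisms ($a,l,r,a',l',r',d,n,n'$) are identities. **Notation.** $\underline{n}=1+\cdots+1$ ($n$ summands of the unit object $1$ of $\mathbb{S}$), $\underline{0}=0$. The contractible category with a given (non-empty) set of objects is the category with exactly one morphism between any two objects. *)

(* Defs.v *)
From mathcomp Require Import all_boot.
From mathcomp.classical Require Import boolp.

Set Implicit Arguments.
Unset Strict Implicit.
Unset Printing Implicit Defensive.

Declare Scope cat_scope.
Delimit Scope cat_scope with cat.
Local Open Scope cat_scope.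

Record category := Category {
  obj :> Type;
  hom : obj -> obj -> Type;
  idm : forall x, hom x x;
  compm : forall x y z, hom y z -> hom x y -> hom x z;
  compmA : forall w x y z (h : hom y z) (g : hom x y) (f : hom w x),
    compm h (compm g f) = compm (compm h g) f;
  comp1m : forall x y (f : hom x y), compm (idm y) f = f;
  compm1 : forall x y (f : hom x y), compm f (idm x) = f
}.

Notation "x ~> y" := (hom x y)
  (at level 90, right associativity) : cat_scope.
(* [g ∘ f] is [f] followed by [g]. *)
Notation "g ∘ f" := (compm g f) (at level 40, left associativity) : cat_scope.

Record iso (C : category) (x y : C) := Iso {
  isof :> x ~> y;
  isoi : y ~> x;
  isoK : isoi ∘ isof = idm x;
  isoKi : isof ∘ isoi = idm y
}.

Definition iso_inv (C : category) (x y : C) (f : iso x y) : iso y x :=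
  Iso (isoKi f) (isoK f).

Definition isomorphic (C : category) (x y : C) : Prop := inhabited (iso x y).

(* A morphism [x ~> y] is an identity when [x] and [y] are the same object and
   the morphism is the identity of that object. *)
Inductive is_identity (C : category) (x : C) : forall y : C, (x ~> y) -> Prop :=
  IsIdentity : is_identity (idm x).

Definition skeletal (C : category) : Prop :=
  forall x y : C, isomorphic x y -> x = y.

Record functor (C D : category) := Functor {
  fobj :> C -> D;
  fmap : forall x y, (x ~> y) -> (fobj x ~> fobj y);
  fmap_id : forall x, fmap (idm x) = idm (fobj x);
  fmap_comp : forall x y z (g : y ~> z) (f : x ~> y),
    fmap (g ∘ f) = fmap g ∘ fmap f
}.

Definition functor_id (C : category) : functor C C :=
  @Functor C C id (fun _ _ f => f) (fun _ => erefl) (fun _ _ _ _ _ => erefl).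

Program Definition functor_comp (C D E : category)
    (G : functor D E) (F : functor C D) : functor C E :=
  @Functor C E (fun x => G (F x)) (fun _ _ f => fmap G (fmap F f)) _ _.
Next Obligation. by rewrite !fmap_id. Qed.
Next Obligation. by rewrite !fmap_comp. Qed.

Definition isomorphic_categories (C D : category) : Prop :=
  exists (F : functor C D) (G : functor D C),
    functor_comp G F = functor_id C /\ functor_comp F G = functor_id D.

Program Definition contractible_category (X : Type) : category :=
  @Category X (fun _ _ => unit) (fun _ => tt) (fun _ _ _ _ _ => tt) _ _ _.
Next Obligation. by case: f. Qed.
Next Obligation. by case: f. Qed.

Record monoidal (C : category) := Monoidal {
  tens : C -> C -> C;
  tensm : forall x x' y y', (x ~> x') -> (y ~> y') -> (tens x y ~> tens x' y');
  munit : C;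
  assoc : forall x y z, iso (tens x (tens y z)) (tens (tens x y) z);
  lunit : forall x, iso (tens munit x) x;
  runit : forall x, iso (tens x munit) x;
  tensm_id : forall x y, tensm (idm x) (idm y) = idm (tens x y);
  tensm_comp : forall x x' x'' y y' y''
      (f' : x' ~> x'') (f : x ~> x') (g' : y' ~> y'') (g : y ~> y'),
    tensm (f' ∘ f) (g' ∘ g) = tensm f' g' ∘ tensm f g;
  assoc_nat : forall x x' y y' z z'
      (f : x ~> x') (g : y ~> y') (h : z ~> z'),
    assoc x' y' z' ∘ tensm f (tensm g h) = tensm (tensm f g) h ∘ assoc x y z;
  lunit_nat : forall x x' (f : x ~> x'),
    lunit x' ∘ tensm (idm munit) f = f ∘ lunit x;
  runit_nat : forall x x' (f : x ~> x'),
    runit x' ∘ tensm f (idm munit) = f ∘ runit x;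
  pentagon : forall x y z t,
    assoc (tens x y) z t ∘ assoc x y (tens z t)
    = tensm (assoc x y z) (idm t) ∘ assoc x (tens y z) t
      ∘ tensm (idm x) (assoc y z t);
  triangle : forall x y,
    tensm (runit x) (idm y) ∘ assoc x munit y = tensm (idm x) (lunit y)
}.

Record symmetry (C : category) (M : monoidal C) := Symmetry {
  braid :> forall x y, iso (tens M x y) (tens M y x);
  braid_nat : forall x x' y y' (f : x ~> x') (g : y ~> y'),
    braid x' y' ∘ tensm M f g = tensm M g f ∘ braid x y;
  braidK : forall x y, braid y x ∘ braid x y = idm (tens M x y);
  hexagon : forall x y z,
    assoc M z x y ∘ braid (tens M x y) z ∘ assoc M x y z
    = tensm M (braid x z) (idm y) ∘ assoc M x z y
      ∘ tensm M (idm x) (braid y z)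
}.

Record rig_data := RigData {
  rig_cat :> category;
  rig_add : monoidal rig_cat;
  rig_c : symmetry rig_add;
  rig_mul : monoidal rig_cat;
  rig_d : forall x y z,
    iso (tens rig_mul x (tens rig_add y z))
        (tens rig_add (tens rig_mul x y) (tens rig_mul x z));
  rig_d' : forall x y z,
    iso (tens rig_mul (tens rig_add x y) z)
        (tens rig_add (tens rig_mul x z) (tens rig_mul y z));
  rig_n : forall x, iso (tens rig_mul x (munit rig_add)) (munit rig_add);
  rig_n' : forall x, iso (tens rig_mul (munit rig_add) x) (munit rig_add)
}.

Definition radd (S : rig_data) (x y : S) : S := tens (rig_add S) x y.
Definition raddm (S : rig_data) (x x' y y' : S) (f : x ~> x') (g : y ~> y') :
  radd x y ~> radd x' y' := tensm (rig_add S) f g.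
Definition rmul (S : rig_data) (x y : S) : S := tens (rig_mul S) x y.
Definition rmulm (S : rig_data) (x x' y y' : S) (f : x ~> x') (g : y ~> y') :
  rmul x y ~> rmul x' y' := tensm (rig_mul S) f g.
Definition r0 (S : rig_data) : S := munit (rig_add S).
Definition r1 (S : rig_data) : S := munit (rig_mul S).
Arguments r0 {S}.
Arguments r1 {S}.

Declare Scope rig_scope.
Delimit Scope rig_scope with rig.
Local Open Scope rig_scope.
Notation "x ⊕ y" := (radd x y) (at level 50, left associativity) : rig_scope.
Notation "x ⊗ y" := (rmul x y) (at level 40, left associativity) : rig_scope.
Notation "f ⊞ g" := (raddm f g) (at level 50, left associativity) : rig_scope.
Notation "f ⊠ g" := (rmulm f g) (at level 40, left associativity) : rig_scope.

Section Structural.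
Context {S : rig_data}.
Implicit Types x y z p q s u : S.

Definition a_ x y z : iso (x ⊕ (y ⊕ z)) ((x ⊕ y) ⊕ z) := assoc (rig_add S) x y z.
Definition c_ x y : iso (x ⊕ y) (y ⊕ x) := rig_c S x y.
Definition l_ x : iso (r0 ⊕ x) x := lunit (rig_add S) x.
Definition r_ x : iso (x ⊕ r0) x := runit (rig_add S) x.
Definition a'_ x y z : iso (x ⊗ (y ⊗ z)) ((x ⊗ y) ⊗ z) := assoc (rig_mul S) x y z.
Definition l'_ x : iso (r1 ⊗ x) x := lunit (rig_mul S) x.
Definition r'_ x : iso (x ⊗ r1) x := runit (rig_mul S) x.
Definition d_ x y z : iso (x ⊗ (y ⊕ z)) ((x ⊗ y) ⊕ (x ⊗ z)) := rig_d x y z.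
Definition d'_ x y z : iso ((x ⊕ y) ⊗ z) ((x ⊗ z) ⊕ (y ⊗ z)) := rig_d' x y z.
Definition n_ x : iso (x ⊗ r0) r0 := rig_n x.
Definition n'_ x : iso (r0 ⊗ x) r0 := rig_n' x.

Definition v_ p q s u : (p ⊕ q) ⊕ (s ⊕ u) ~> (p ⊕ s) ⊕ (q ⊕ u) :=
  a_ p s (q ⊕ u)
  ∘ (idm p ⊞ isoi (a_ s q u))
  ∘ (idm p ⊞ (c_ q s ⊞ idm u))
  ∘ (idm p ⊞ a_ q s u)
  ∘ isoi (a_ p q (s ⊕ u)).

End Structural.

Record rig_axioms (S : rig_data) : Prop := RigAxioms {
  rig_d_nat : forall (x x' y y' z z' : S)
      (f : x ~> x') (g : y ~> y') (h : z ~> z'),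
    d_ x' y' z' ∘ (f ⊠ (g ⊞ h)) = ((f ⊠ g) ⊞ (f ⊠ h)) ∘ d_ x y z;
  rig_d'_nat : forall (x x' y y' z z' : S)
      (f : x ~> x') (g : y ~> y') (h : z ~> z'),
    d'_ x' y' z' ∘ ((f ⊞ g) ⊠ h) = ((f ⊠ h) ⊞ (g ⊠ h)) ∘ d'_ x y z;
  rig_n_nat : forall (x x' : S) (f : x ~> x'),
    n_ x' ∘ (f ⊠ idm r0) = n_ x;
  rig_n'_nat : forall (x x' : S) (f : x ~> x'),
    n'_ x' ∘ (idm r0 ⊠ f) = n'_ x;

  rig1 : forall x y z t : S,
    (d_ x y z ⊞ idm (x ⊗ t)) ∘ d_ x (y ⊕ z) t ∘ (idm x ⊠ a_ y z t)
    = a_ (x ⊗ y) (x ⊗ z) (x ⊗ t) ∘ (idm (x ⊗ y) ⊞ d_ x z t)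
      ∘ d_ x y (z ⊕ t);
  rig1' : forall x y z t : S,
    (d'_ x y t ⊞ idm (z ⊗ t)) ∘ d'_ (x ⊕ y) z t ∘ (a_ x y z ⊠ idm t)
    = a_ (x ⊗ t) (y ⊗ t) (z ⊗ t) ∘ (idm (x ⊗ t) ⊞ d'_ y z t)
      ∘ d'_ x (y ⊕ z) t;

  rig2 : forall x y z : S,
    d_ x z y ∘ (idm x ⊠ c_ y z) = c_ (x ⊗ y) (x ⊗ z) ∘ d_ x y z;
  rig2' : forall x y z : S,
    d'_ z y x ∘ (c_ y z ⊠ idm x) = c_ (y ⊗ x) (z ⊗ x) ∘ d'_ y z x;

  rig3 : forall x y : S,
    l_ (x ⊗ y) ∘ (n_ x ⊞ idm (x ⊗ y)) ∘ d_ x r0 y = idm x ⊠ l_ y;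
  rig3' : forall x y : S,
    l_ (x ⊗ y) ∘ (n'_ y ⊞ idm (x ⊗ y)) ∘ d'_ r0 x y = l_ x ⊠ idm y;

  rig4 : forall x y : S,
    r_ (x ⊗ y) ∘ (idm (x ⊗ y) ⊞ n_ x) ∘ d_ x y r0 = idm x ⊠ r_ y;
  rig4' : forall x y : S,
    r_ (x ⊗ y) ∘ (idm (x ⊗ y) ⊞ n'_ y) ∘ d'_ x r0 y = r_ x ⊠ idm y;

  rig5 : forall x y z t : S,
    (a'_ x z y ⊞ a'_ x t y) ∘ d_ x (z ⊗ y) (t ⊗ y) ∘ (idm x ⊠ d'_ z t y)
    = d'_ (x ⊗ z) (x ⊗ t) y ∘ (d_ x z t ⊠ idm y) ∘ a'_ x (z ⊕ t) y;
  rig5_0 : forall x y : S,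
    n'_ y ∘ (n_ x ⊠ idm y) ∘ a'_ x r0 y = n_ x ∘ (idm x ⊠ n'_ y);

  rig6 : forall x y z t : S,
    (a'_ x y z ⊞ a'_ x y t) ∘ d_ x (y ⊗ z) (y ⊗ t) ∘ (idm x ⊠ d_ y z t)
    = d_ (x ⊗ y) z t ∘ a'_ x y (z ⊕ t);
  rig6_0 : forall x y : S,
    n_ (x ⊗ y) ∘ a'_ x y r0 = n_ x ∘ (idm x ⊠ n_ y);
  rig6' : forall x y z t : S,
    d'_ (t ⊗ y) (z ⊗ y) x ∘ (d'_ t z y ⊠ idm x) ∘ a'_ (t ⊕ z) y x
    = (a'_ t y x ⊞ a'_ z y x) ∘ d'_ t z (y ⊗ x);
  rig6'_0 : forall x y : S,
    n'_ x ∘ (n'_ y ⊠ idm x) ∘ a'_ r0 y x = n'_ (y ⊗ x);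

  rig7 : forall x y z t : S,
    v_ (x ⊗ z) (x ⊗ t) (y ⊗ z) (y ⊗ t) ∘ (d_ x z t ⊞ d_ y z t)
      ∘ d'_ x y (z ⊕ t)
    = (d'_ x y z ⊞ d'_ x y t) ∘ d_ (x ⊕ y) z t;
  rig7_0 : forall x y : S,
    l_ r0 ∘ (n_ x ⊞ n_ y) ∘ d'_ x y r0 = n_ (x ⊕ y);
  rig7'_0 : forall x y : S,
    l_ r0 ∘ (n'_ x ⊞ n'_ y) ∘ d_ r0 x y = n'_ (x ⊕ y);

  rig8 : forall x y : S,
    (l'_ x ⊞ l'_ y) ∘ d_ r1 x y = l'_ (x ⊕ y);
  rig8' : forall x y : S,
    (r'_ x ⊞ r'_ y) ∘ d'_ x y r1 = r'_ (x ⊕ y);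
  rig8_0 : n_ r1 = l'_ r0 :> ((r1 ⊗ r0 : S) ~> r0);
  rig8'_0 : n'_ r1 = r'_ r0 :> ((r0 ⊗ r1 : S) ~> r0);

  rig9 : n_ r0 = n'_ r0 :> ((r0 ⊗ r0 : S) ~> r0)
}.

Record rigcat := RigCat {
  rigcat_data :> rig_data;
  rigcat_axioms : rig_axioms rigcat_data
}.

Record left_semistrict (S : rigcat) : Prop := LeftSemistrict {
  strict_a : forall x y z : S, is_identity (a_ x y z);
  strict_l : forall x : S, is_identity (l_ x);
  strict_r : forall x : S, is_identity (r_ x);
  strict_a' : forall x y z : S, is_identity (a'_ x y z);
  strict_l' : forall x : S, is_identity (l'_ x);
  strict_r' : forall x : S, is_identity (r'_ x);
  strict_d : forall x y z : S, is_identity (d_ x y z);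
  strict_n : forall x : S, is_identity (n_ x);
  strict_n' : forall x : S, is_identity (n'_ x)
}.

(* Sum of [n] copies of the unit object, bracketed to the left; for [0 < n] the
   zero object is not among the summands. *)
Fixpoint nfold (S : rigcat) (n : nat) : S :=
  match n with
  | 0 => r0
  | 1 => r1
  | m.+1 => nfold S m ⊕ r1
  end.

Record rig_hom (S T : rigcat) := RigHom {
  rh_fun :> functor S T;
  rh_add : forall x y : S, iso (rh_fun (x ⊕ y)) (rh_fun x ⊕ rh_fun y);
  rh_zero : iso (rh_fun r0) r0;
  rh_mul : forall x y : S, iso (rh_fun (x ⊗ y)) (rh_fun x ⊗ rh_fun y);
  rh_one : iso (rh_fun r1) r1;

  rh_add_nat : forall (x x' y y' : S) (f : x ~> x') (g : y ~> y'),
    rh_add x' y' ∘ fmap rh_fun (f ⊞ g)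
    = (fmap rh_fun f ⊞ fmap rh_fun g) ∘ rh_add x y;
  rh_add_a : forall x y z : S,
    (rh_add x y ⊞ idm (rh_fun z)) ∘ rh_add (x ⊕ y) z ∘ fmap rh_fun (a_ x y z)
    = a_ (rh_fun x) (rh_fun y) (rh_fun z)
      ∘ (idm (rh_fun x) ⊞ rh_add y z) ∘ rh_add x (y ⊕ z);
  rh_add_l : forall x : S,
    l_ (rh_fun x) ∘ (rh_zero ⊞ idm (rh_fun x)) ∘ rh_add r0 x
    = fmap rh_fun (l_ x);
  rh_add_r : forall x : S,
    r_ (rh_fun x) ∘ (idm (rh_fun x) ⊞ rh_zero) ∘ rh_add x r0
    = fmap rh_fun (r_ x);
  rh_add_c : forall x y : S,
    rh_add y x ∘ fmap rh_fun (c_ x y) = c_ (rh_fun x) (rh_fun y) ∘ rh_add x y;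

  rh_mul_nat : forall (x x' y y' : S) (f : x ~> x') (g : y ~> y'),
    rh_mul x' y' ∘ fmap rh_fun (f ⊠ g)
    = (fmap rh_fun f ⊠ fmap rh_fun g) ∘ rh_mul x y;
  rh_mul_a : forall x y z : S,
    (rh_mul x y ⊠ idm (rh_fun z)) ∘ rh_mul (x ⊗ y) z ∘ fmap rh_fun (a'_ x y z)
    = a'_ (rh_fun x) (rh_fun y) (rh_fun z)
      ∘ (idm (rh_fun x) ⊠ rh_mul y z) ∘ rh_mul x (y ⊗ z);
  rh_mul_l : forall x : S,
    l'_ (rh_fun x) ∘ (rh_one ⊠ idm (rh_fun x)) ∘ rh_mul r1 x
    = fmap rh_fun (l'_ x);
  rh_mul_r : forall x : S,
    r'_ (rh_fun x) ∘ (idm (rh_fun x) ⊠ rh_one) ∘ rh_mul x r1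
    = fmap rh_fun (r'_ x);

  rh_d : forall x y z : S,
    (rh_mul x y ⊞ rh_mul x z) ∘ rh_add (x ⊗ y) (x ⊗ z) ∘ fmap rh_fun (d_ x y z)
    = d_ (rh_fun x) (rh_fun y) (rh_fun z)
      ∘ (idm (rh_fun x) ⊠ rh_add y z) ∘ rh_mul x (y ⊕ z);
  rh_d' : forall x y z : S,
    (rh_mul y x ⊞ rh_mul z x) ∘ rh_add (y ⊗ x) (z ⊗ x) ∘ fmap rh_fun (d'_ y z x)
    = d'_ (rh_fun y) (rh_fun z) (rh_fun x)
      ∘ (rh_add y z ⊠ idm (rh_fun x)) ∘ rh_mul (y ⊕ z) x;
  rh_n : forall x : S,
    rh_zero ∘ fmap rh_fun (n_ x)
    = n_ (rh_fun x) ∘ (idm (rh_fun x) ⊠ rh_zero) ∘ rh_mul x r0;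
  rh_n' : forall x : S,
    rh_zero ∘ fmap rh_fun (n'_ x)
    = n'_ (rh_fun x) ∘ (rh_zero ⊠ idm (rh_fun x)) ∘ rh_mul r0 x
}.

Record rig_trans (S T : rigcat) (F G : rig_hom S T) := RigTrans {
  rt_map :> forall x : S, F x ~> G x;
  rt_nat : forall (x y : S) (f : x ~> y),
    rt_map y ∘ fmap F f = fmap G f ∘ rt_map x;
  rt_add : forall x y : S,
    rh_add G x y ∘ rt_map (x ⊕ y) = (rt_map x ⊞ rt_map y) ∘ rh_add F x y;
  rt_zero : rh_zero G ∘ rt_map r0 = rh_zero F;
  rt_mul : forall x y : S,
    rh_mul G x y ∘ rt_map (x ⊗ y) = (rt_map x ⊠ rt_map y) ∘ rh_mul F x y;
  rt_one : rh_one G ∘ rt_map r1 = rh_one F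
}.

Lemma rig_trans_eq (S T : rigcat) (F G : rig_hom S T) (s t : rig_trans F G) :
  (forall x, s x = t x) -> s = t.
Proof.
case: s t => [s s1 s2 s3 s4 s5] [t t1 t2 t3 t4 t5] /= est.
have {}est : s = t by apply: functional_extensionality_dep.
by case: _ / est in t1 t2 t3 t4 t5 *; congr RigTrans; apply: Prop_irrelevance.
Qed.

Lemma raddm_id (S : rig_data) (x y : S) : idm x ⊞ idm y = idm (x ⊕ y).
Proof. exact: tensm_id. Qed.

Lemma rmulm_id (S : rig_data) (x y : S) : idm x ⊠ idm y = idm (x ⊗ y).
Proof. exact: tensm_id. Qed.

Lemma raddm_comp (S : rig_data) (x x' x'' y y' y'' : S)
    (f' : x' ~> x'') (f : x ~> x') (g' : y' ~> y'') (g : y ~> y') :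
  (f' ∘ f) ⊞ (g' ∘ g) = (f' ⊞ g') ∘ (f ⊞ g).
Proof. exact: tensm_comp. Qed.

Lemma rmulm_comp (S : rig_data) (x x' x'' y y' y'' : S)
    (f' : x' ~> x'') (f : x ~> x') (g' : y' ~> y'') (g : y ~> y') :
  (f' ∘ f) ⊠ (g' ∘ g) = (f' ⊠ g') ∘ (f ⊠ g).
Proof. exact: tensm_comp. Qed.

Program Definition rig_trans_id (S T : rigcat) (F : rig_hom S T) :
  rig_trans F F := @RigTrans S T F F (fun x => idm (F x)) _ _ _ _ _.
Next Obligation. by rewrite comp1m compm1. Qed.
Next Obligation. by rewrite raddm_id comp1m compm1. Qed.
Next Obligation. by rewrite compm1. Qed.
Next Obligation. by rewrite rmulm_id comp1m compm1. Qed.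
Next Obligation. by rewrite compm1. Qed.

Program Definition rig_trans_comp (S T : rigcat) (F G H : rig_hom S T)
    (t : rig_trans G H) (s : rig_trans F G) : rig_trans F H :=
  @RigTrans S T F H (fun x => t x ∘ s x) _ _ _ _ _.
Next Obligation. by rewrite -compmA rt_nat !compmA rt_nat. Qed.
Next Obligation. by rewrite compmA rt_add raddm_comp -!compmA rt_add. Qed.
Next Obligation. by rewrite compmA !rt_zero. Qed.
Next Obligation. by rewrite compmA rt_mul rmulm_comp -!compmA rt_mul. Qed.
Next Obligation. by rewrite compmA !rt_one. Qed.

Program Definition HomRigCat (S T : rigcat) : category :=
  @Category (rig_hom S T) (@rig_trans S T) (@rig_trans_id S T)
    (@rig_trans_comp S T) _ _ _.
Next Obligation. by apply: rig_trans_eq => a /=; rewrite compmA. Qed.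
Next Obligation. by apply: rig_trans_eq => a /=; rewrite comp1m. Qed.
Next Obligation. by apply: rig_trans_eq => a /=; rewrite compm1. Qed.

(* The object [n] is the natural number [n], standing for ['I_n]: elements are
   numbered from 0, so the formulas below are the usual ones for {1, ..., n}
   with all indices shifted by one. *)

Definition finbij (m n : nat) := {f : 'I_m -> 'I_n | bijective f}.
Definition finfn m n (f : finbij m n) : 'I_m -> 'I_n := sval f.
Coercion finfn : finbij >-> Funclass.

Lemma finbij_eq m n (f g : finbij m n) : (forall k, f k = g k) -> f = g.
Proof.
case: f g => [f fb] [g gb] /= /funext fg.
by case: _ / fg in gb *; congr exist; apply: Prop_irrelevance.
Qed.

Definition finbij_id n : finbij n n := exist _ id (Bijective (frefl id) (frefl id)).

Definition finbij_comp m n p (g : finbij n p) (f : finbij m n) : finbij m p :=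
  exist _ (g \o f) (bij_comp (svalP g) (svalP f)).

Program Definition FSet_cat : category :=
  @Category nat finbij finbij_id finbij_comp _ _ _.
Next Obligation. exact: finbij_eq. Qed.
Next Obligation. exact: finbij_eq. Qed.
Next Obligation. exact: finbij_eq. Qed.

Program Definition finiso m n (f : 'I_m -> 'I_n) (g : 'I_n -> 'I_m)
    (fK : cancel f g) (gK : cancel g f) : @iso FSet_cat m n :=
  @Iso FSet_cat m n (exist _ f (Bijective fK gK)) (exist _ g (Bijective gK fK))
    _ _.
Next Obligation. exact: finbij_eq. Qed.
Next Obligation. exact: finbij_eq. Qed.

(* An identity between objects of the form [m] and [n], [m] and [n] being equal
   but not necessarily convertible numbers; see [finid_identity]. *)
Definition finid m n (e : m = n) : @iso FSet_cat m n :=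
  finiso (cast_ordK e) (cast_ordKV e).

Lemma finid_identity m n (e : m = n) : is_identity (finid e).
Proof.
case: _ / e; have -> : isof (finid (erefl m)) = @idm FSet_cat m.
  by apply: finbij_eq => k; apply: val_inj.
exact: IsIdentity.
Qed.

Definition ordadd m m' n n' (f : 'I_m -> 'I_m') (g : 'I_n -> 'I_n')
    (k : 'I_(m + n)) : 'I_(m' + n') :=
  match split k with inl i => lshift n' (f i) | inr j => rshift m' (g j) end.

Lemma ordpair_subproof m n (i : 'I_m) (j : 'I_n) : j * m + i < m * n.
Proof.
apply: (@leq_trans (j.+1 * m)); first by rewrite mulSn addnC ltn_add2r.
by rewrite mulnC leq_mul2l ltn_ord orbT.
Qed.

(* 'I_m * 'I_n is identified with 'I_(m * n), the first coordinate varying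
   fastest. *)
Definition ordpair m n (i : 'I_m) (j : 'I_n) : 'I_(m * n) :=
  Ordinal (ordpair_subproof i j).

Lemma ordfst_subproof m n (k : 'I_(m * n)) : k %% m < m.
Proof. by case: m k => [[]//|m] k; rewrite ltn_pmod. Qed.
Definition ordfst m n (k : 'I_(m * n)) : 'I_m := Ordinal (ordfst_subproof k).

Lemma ordsnd_subproof m n (k : 'I_(m * n)) : k %/ m < n.
Proof. by case: m k => [[]//|m] k; rewrite ltn_divLR // [(n * _)%N]mulnC. Qed.
Definition ordsnd m n (k : 'I_(m * n)) : 'I_n := Ordinal (ordsnd_subproof k).

Definition ordmul m m' n n' (f : 'I_m -> 'I_m') (g : 'I_n -> 'I_n')
    (k : 'I_(m * n)) : 'I_(m' * n') :=
  ordpair (f (ordfst k)) (g (ordsnd k)).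

Definition ordC m n (k : 'I_(m + n)) : 'I_(n + m) :=
  match split k with inl i => rshift n i | inr j => lshift m j end.

(* The permutation of [(m + n)p] whose inverse is the right distributor. *)
Definition orddbar m n p (k : 'I_(m * p + n * p)) : 'I_((m + n) * p) :=
  match split k with
  | inl u => ordpair (lshift n (ordfst u)) (ordsnd u)
  | inr u => ordpair (rshift m (ordfst u)) (ordsnd u)
  end.

Definition orddbar_inv m n p (k : 'I_((m + n) * p)) : 'I_(m * p + n * p) :=
  match split (ordfst k) with
  | inl i => lshift (n * p) (ordpair i (ordsnd k))
  | inr i => rshift (m * p) (ordpair i (ordsnd k))
  end.

Lemma split_lshift m n (i : 'I_m) : split (lshift n i) = inl i.
Proof. exact: (unsplitK (inl i)). Qed.
Lemma split_rshift m n (i : 'I_n) : split (rshift m i) = inr i.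
Proof. exact: (unsplitK (inr i)). Qed.

Lemma ordfstE m n (i : 'I_m) (j : 'I_n) : ordfst (ordpair i j) = i.
Proof. by apply: val_inj; rewrite /= modnMDl modn_small. Qed.

Lemma ordsndE m n (i : 'I_m) (j : 'I_n) : ordsnd (ordpair i j) = j.
Proof.
apply: val_inj; rewrite /= divnMDl ?divn_small ?addn0 //.
exact: leq_ltn_trans (ltn_ord i).
Qed.

Lemma ordpairP m n (P : 'I_(m * n) -> Prop) :
  (forall i j, P (ordpair i j)) -> forall k, P k.
Proof.
move=> H k; have -> : k = ordpair (ordfst k) (ordsnd k); last exact: H.
by apply: val_inj; rewrite /= -divn_eq.
Qed.

Lemma ordsumP m n (P : 'I_(m + n) -> Prop) :
  (forall i, P (lshift n i)) -> (forall j, P (rshift m j)) -> forall k, P k.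
Proof. by move=> Hl Hr k; rewrite -(splitK k); case: (split k). Qed.

Section OrdEval.
Variables m m' n n' p : nat.

Lemma ordaddL (f : 'I_m -> 'I_m') (g : 'I_n -> 'I_n') i :
  ordadd f g (lshift n i) = lshift n' (f i).
Proof. by rewrite /ordadd split_lshift. Qed.
Lemma ordaddR (f : 'I_m -> 'I_m') (g : 'I_n -> 'I_n') j :
  ordadd f g (rshift m j) = rshift m' (g j).
Proof. by rewrite /ordadd split_rshift. Qed.
Lemma ordmulE (f : 'I_m -> 'I_m') (g : 'I_n -> 'I_n') i j :
  ordmul f g (ordpair i j) = ordpair (f i) (g j).
Proof. by rewrite /ordmul ordfstE ordsndE. Qed.
Lemma ordCL i : ordC (lshift n i) = rshift n i :> 'I_(n + m).
Proof. by rewrite /ordC split_lshift. Qed.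
Lemma ordCR j : ordC (rshift m j) = lshift m j :> 'I_(n + m).
Proof. by rewrite /ordC split_rshift. Qed.
Lemma orddbarL (i : 'I_m) (j : 'I_p) :
  orddbar (lshift (n * p) (ordpair i j)) = ordpair (lshift n i) j.
Proof. by rewrite /orddbar split_lshift ordfstE ordsndE. Qed.
Lemma orddbarR (i : 'I_n) (j : 'I_p) :
  orddbar (rshift (m * p) (ordpair i j)) = ordpair (rshift m i) j.
Proof. by rewrite /orddbar split_rshift ordfstE ordsndE. Qed.
Lemma orddbar_invL (i : 'I_m) (j : 'I_p) :
  orddbar_inv (ordpair (lshift n i) j) = lshift (n * p) (ordpair i j).
Proof. by rewrite /orddbar_inv ordfstE split_lshift ordsndE. Qed.
Lemma orddbar_invR (i : 'I_n) (j : 'I_p) :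
  orddbar_inv (ordpair (rshift m i) j) = rshift (m * p) (ordpair i j).
Proof. by rewrite /orddbar_inv ordfstE split_rshift ordsndE. Qed.

Lemma cast_addAL e (i : 'I_m) :
  cast_ord e (lshift (n + p) i) = lshift p (lshift n i).
Proof. exact: val_inj. Qed.
Lemma cast_addAM e (i : 'I_n) :
  cast_ord e (rshift m (lshift p i)) = lshift p (rshift m i).
Proof. exact: val_inj. Qed.
Lemma cast_addAR e (i : 'I_p) :
  cast_ord e (rshift m (rshift n i)) = rshift (m + n) i.
Proof. by apply: val_inj; rewrite /= addnA. Qed.
Lemma cast_addAL' e (i : 'I_m) :
  cast_ord e (lshift p (lshift n i)) = lshift (n + p) i.
Proof. exact: val_inj. Qed.
Lemma cast_addAM' e (i : 'I_n) :
  cast_ord e (lshift p (rshift m i)) = rshift m (lshift p i).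
Proof. exact: val_inj. Qed.
Lemma cast_addAR' e (i : 'I_p) :
  cast_ord e (rshift (m + n) i) = rshift m (rshift n i).
Proof. by apply: val_inj; rewrite /= addnA. Qed.
Lemma cast_add0 e (i : 'I_m) : cast_ord e (rshift 0 i) = i.
Proof. exact: val_inj. Qed.
Lemma cast_addn0 e (i : 'I_m) : cast_ord e (lshift 0 i) = i.
Proof. exact: val_inj. Qed.
Lemma cast_mulA e (i : 'I_m) (j : 'I_n) (k : 'I_p) :
  cast_ord e (ordpair i (ordpair j k)) = ordpair (ordpair i j) k.
Proof. by apply: val_inj; rewrite /= mulnDl addnA -mulnA (mulnC n). Qed.
Lemma cast_mul1 e (i : 'I_1) (j : 'I_n) : cast_ord e (ordpair i j) = j.
Proof. by apply: val_inj; rewrite /= ord1 muln1 addn0. Qed.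
Lemma cast_muln1 e (i : 'I_n) (j : 'I_1) : cast_ord e (ordpair i j) = i.
Proof. by apply: val_inj; rewrite /= ord1 mul0n. Qed.
Lemma cast_mulDL e (i : 'I_m) (j : 'I_n) :
  cast_ord e (ordpair i (lshift p j)) = lshift (m * p) (ordpair i j).
Proof. exact: val_inj. Qed.
Lemma cast_mulDR e (i : 'I_m) (j : 'I_p) :
  cast_ord e (ordpair i (rshift n j)) = rshift (m * n) (ordpair i j).
Proof. by apply: val_inj; rewrite /= mulnDl -addnA (mulnC n). Qed.

End OrdEval.

Definition ordE := (ordaddL, ordaddR, ordmulE, ordCL, ordCR, orddbarL, orddbarR,
  orddbar_invL, orddbar_invR, cast_addAL, cast_addAM, cast_addAR, cast_addAL',
  cast_addAM', cast_addAR', cast_add0, cast_addn0, cast_mulA, cast_mul1,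
  cast_muln1, cast_mulDL, cast_mulDR).

Ltac ord_cases :=
  let k := fresh "k" in intro k;
  lazymatch type of k with
  | ordinal 0 => by case: k
  | ordinal (addn _ _) => revert k; refine (ordsumP _ _); ord_cases
  | ordinal (muln _ _) =>
      revert k; refine (ordpairP _);
      let i := fresh "i" in intro i; revert i; ord_cases_fst
  | _ => idtac
  end
with ord_cases_fst :=
  let i := fresh "i" in intro i;
  lazymatch type of i with
  | ordinal 0 => by case: i
  | ordinal (addn _ _) =>
      revert i; refine (ordsumP _ _); ord_cases_fst
  | ordinal (muln _ _) =>
      revert i; refine (ordpairP _); ord_cases_fst
  | ordinal _ =>
     lazymatch goal with |- forall _ : ordinal _, _ => ord_cases | _ => idtac end
  end.

Lemma ordC_K m n : cancel (@ordC m n) (@ordC n m).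
Proof. by apply: ordsumP => i; rewrite !ordE. Qed.

Lemma orddbarK m n p : cancel (@orddbar m n p) (@orddbar_inv m n p).
Proof. by apply: ordsumP; apply: ordpairP => i j; rewrite !ordE. Qed.

Lemma orddbar_invK m n p : cancel (@orddbar_inv m n p) (@orddbar m n p).
Proof.
by apply: ordpairP => i j; elim/ordsumP: i => i; rewrite !ordE.
Qed.

Program Definition finadd m m' n n' (f : finbij m m') (g : finbij n n') :
  finbij (m + n) (m' + n') := exist _ (ordadd f g) _.
Next Obligation.
move: (svalP f) (svalP g) => [f' fK f'K] [g' gK g'K]; exists (ordadd f' g').
  by apply: ordsumP => i; rewrite !ordE ?fK ?gK.
by apply: ordsumP => i; rewrite !ordE /finfn ?f'K ?g'K.
Qed.

Program Definition finmul m m' n n' (f : finbij m m') (g : finbij n n') :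
  finbij (m * n) (m' * n') := exist _ (ordmul f g) _.
Next Obligation.
move: (svalP f) (svalP g) => [f' fK f'K] [g' gK g'K]; exists (ordmul f' g').
  by apply: ordpairP => i j; rewrite !ordE fK gK.
by apply: ordpairP => i j; rewrite !ordE /finfn f'K g'K.
Qed.

Ltac ord_ext := intros; apply: finbij_eq => /=; rewrite /finfn /=.

Program Definition FSet_add : monoidal FSet_cat :=
  @Monoidal FSet_cat addn finadd 0
    (fun m n p => finid (addnA m n p)) (fun n => finid (add0n n))
    (fun n => finid (addn0 n)) _ _ _ _ _ _ _.
Next Obligation. by ord_ext; ord_cases; rewrite !ordE. Qed.
Next Obligation. by ord_ext; ord_cases; rewrite !ordE. Qed.
Next Obligation. by ord_ext; ord_cases; rewrite !ordE. Qed.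
Next Obligation. by ord_ext; ord_cases; rewrite !ordE. Qed.
Next Obligation. by ord_ext; ord_cases; rewrite !ordE. Qed.
Next Obligation. by ord_ext; ord_cases; rewrite !ordE. Qed.
Next Obligation. by ord_ext; ord_cases; rewrite !ordE. Qed.

Program Definition FSet_c : symmetry FSet_add :=
  @Symmetry FSet_cat FSet_add
    (fun m n => finiso (@ordC_K m n) (@ordC_K n m)) _ _ _.
Next Obligation. by ord_ext; ord_cases; rewrite !ordE. Qed.
Next Obligation. by ord_ext; ord_cases; rewrite !ordE. Qed.
Next Obligation. by ord_ext; ord_cases; rewrite !ordE. Qed.

Program Definition FSet_mul : monoidal FSet_cat :=
  @Monoidal FSet_cat muln finmul 1
    (fun m n p => finid (mulnA m n p)) (fun n => finid (mul1n n))
    (fun n => finid (muln1 n)) _ _ _ _ _ _ _.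
Next Obligation. by ord_ext; ord_cases; rewrite !ordE. Qed.
Next Obligation. by ord_ext; ord_cases; rewrite !ordE. Qed.
Next Obligation. by ord_ext; ord_cases; rewrite !ordE. Qed.
Next Obligation. by ord_ext; ord_cases; rewrite !ordE. Qed.
Next Obligation. by ord_ext; ord_cases; rewrite !ordE. Qed.
Next Obligation. by ord_ext; ord_cases; rewrite !ordE. Qed.
Next Obligation. by ord_ext; ord_cases; rewrite !ordE. Qed.

Definition FSet_data : rig_data :=
  @RigData FSet_cat FSet_add FSet_c FSet_mul
    (fun m n p => finid (mulnDr m n p))
    (fun m n p => iso_inv (finiso (@orddbarK m n p) (@orddbar_invK m n p)))
    (fun n => finid (muln0 n)) (fun n => finid (mul0n n)).

Lemma FSet_axioms : rig_axioms FSet_data.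
Proof.
split; intros; apply: finbij_eq; rewrite /radd /rmul /r0 /r1 /= /finfn /=.
all: ord_cases; rewrite ?ordE //.
Qed.

Definition FSet_sk : rigcat := RigCat FSet_axioms.

Lemma FSet_sk_left_semistrict : left_semistrict FSet_sk.
Proof. by split=> *; apply: finid_identity. Qed.

Definition Aut (C : category) (x : C) : Type := iso x x.

(* [fs_isomorphic] is implied by [fs_tau]; being proof irrelevant, it does not
   affect which sequences are equal. *)
Record framed_sequence (S : rigcat) := FramedSequence {
  fs_obj : nat -> S;
  fs_isomorphic : forall n, isomorphic (fs_obj n) (nfold S n);
  fs_tau : forall n, iso (fs_obj n) (nfold S n)
}.

(* Main.v *)
Require Import Defs.
From mathcomp Require Import all_boot.
From mathcomp Require Import zify.
From mathcomp.classical Require Import boolp.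

Set Implicit Arguments.
Unset Strict Implicit.
Unset Printing Implicit Defensive.
Local Open Scope cat_scope.
Local Open Scope rig_scope.

(** Write [n] for the finite set with [n] elements, so that [n.+1] is the sum of
    the unit [1] and [n].

    Any two homomorphisms [F] and [G] from the permutation groupoid to a rig
    category are related by exactly one rig transformation, and it is
    invertible. Compatibility with the units and with the sum of [1] and [n]
    determines the component at [n.+1] from the component at [n]
    ([rig_trans_unique]). Conversely, the components defined by this recursion
    are additive because addition is associative; they are natural because
    every permutation is obtained from identities and from exchanges of the
    first two elements by composing and by adding a fixed first element
    ([perm_ind]); and they are multiplicative because [m ⊗ n] is a sum of
    copies of [m], by the left distributor ([compare]).

    So, once there is a homomorphism [H] taking [n] to the sum of [n] units of
    [S], each homomorphism [F] yields the objects [F n] with the components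
    [F n ~> H n] of its unique transformation to [H]; and each sequence of
    objects [x n] with isomorphisms [x n ~> H n] yields a homomorphism, by
    transporting the structure of [H] ([transport]). These constructions are
    inverse to each other ([frameK], [unframeK]), since homomorphisms related
    by a transformation with identity components are equal ([rig_hom_eq]). If
    [S] is skeletal, the objects [x n] can only be the sums of units, and what
    is left is a sequence of automorphisms; the isomorphism of categories then
    says no more than that all hom-sets are singletons.

    What remains is to construct [H]: to let permutations act on a sum of units
    of [S] compatibly with everything. A permutation [f] of [n.+1] elements acts
    by first rearranging all inputs but the first one, and then inserting the
    first one at position [f 0] ([act]). That this respects composition comes
    down to composing with the exchange of the first two elements
    ([act_comp_swap]), hence to the fact that inserting two elements in either
    order gives the same result up to that exchange ([ins_ins]), which is the
    braid relation ([swap_braid]), a consequence of the hexagon. As the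
    structural isomorphisms of [S] other than the commutator and the right
    distributor are identities, it remains to see that the action respects [⊞],
    [⊠], the commutator and the right distributor. The axioms of a rig category
    express each of these, for a sum, by its values on the summands, in the same
    way in the permutation groupoid and in [S], so that all of them follow by
    induction from the case of units. *)

(** * Calculating with morphisms *)

Lemma compKm (C : category) (x y z : C) (f : iso y z) (g : x ~> y) :
  isoi f ∘ (f ∘ g) = g.
Proof. by rewrite compmA isoK comp1m. Qed.

Lemma compKVm (C : category) (x y z : C) (f : iso z y) (g : x ~> y) :
  f ∘ (isoi f ∘ g) = g.
Proof. by rewrite compmA isoKi comp1m. Qed.

Lemma compmK (C : category) (x y z : C) (f : iso x y) (g : y ~> z) :
  g ∘ f ∘ isoi f = g.
Proof. by rewrite -compmA isoKi compm1. Qed.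

Lemma compmKV (C : category) (x y z : C) (f : iso y x) (g : y ~> z) :
  g ∘ isoi f ∘ f = g.
Proof. by rewrite -compmA isoK compm1. Qed.

Lemma iso_monic (C : category) (x y z : C) (f : iso y z) (g h : x ~> y) :
  f ∘ g = f ∘ h -> g = h.
Proof. by move=> e; rewrite -(compKm f g) e compKm. Qed.

Lemma iso_epic (C : category) (x y z : C) (f : iso x y) (g h : y ~> z) :
  g ∘ f = h ∘ f -> g = h.
Proof. by move=> e; rewrite -(compmK f g) e compmK. Qed.

Lemma iso_eq (C : category) (x y : C) (f g : iso x y) :
  f = g :> (x ~> y) -> f = g.
Proof.
move=> e; have ei : isoi f = isoi g.
  by rewrite -[LHS]compm1 -(isoKi g) -e compKm.
case: f g e ei => [f f' fK f'K] [g g' gK g'K] /= e ei.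
by case: _ / e in gK g'K *; case: _ / ei in gK g'K *;
   congr Iso; apply: Prop_irrelevance.
Qed.

Definition iso_id (C : category) (x : C) : iso x x :=
  Iso (comp1m (idm x)) (comp1m (idm x)).

Definition iso_comp (C : category) (x y z : C) (g : iso y z) (f : iso x y) :
  iso x z.
Proof.
exists (g ∘ f) (isoi f ∘ isoi g).
  by rewrite -compmA compKm isoK.
by rewrite -compmA compKVm isoKi.
Defined.

Section RigIso.
Variable S : rig_data.
Implicit Types x y z w : S.

Definition radd_iso x x' y y' (f : iso x x') (g : iso y y') :
  iso (x ⊕ y) (x' ⊕ y').
Proof.
exists (f ⊞ g) (isoi f ⊞ isoi g); first by rewrite -raddm_comp !isoK raddm_id.
by rewrite -raddm_comp !isoKi raddm_id.
Defined.

Definition rmul_iso x x' y y' (f : iso x x') (g : iso y y') :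
  iso (x ⊗ y) (x' ⊗ y').
Proof.
exists (f ⊠ g) (isoi f ⊠ isoi g); first by rewrite -rmulm_comp !isoK rmulm_id.
by rewrite -rmulm_comp !isoKi rmulm_id.
Defined.

Lemma radd_isoE x x' y y' (f : iso x x') (g : iso y y') :
  isof (radd_iso f g) = f ⊞ g.
Proof. by []. Qed.

Lemma rmul_isoE x x' y y' (f : iso x x') (g : iso y y') :
  isof (rmul_iso f g) = f ⊠ g.
Proof. by []. Qed.

Lemma a_nat x x' y y' z z' (f : x ~> x') (g : y ~> y') (h : z ~> z') :
  a_ x' y' z' ∘ (f ⊞ (g ⊞ h)) = ((f ⊞ g) ⊞ h) ∘ a_ x y z.
Proof. exact: assoc_nat. Qed.

Lemma l_nat x x' (f : x ~> x') : l_ x' ∘ (idm r0 ⊞ f) = f ∘ l_ x.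
Proof. exact: lunit_nat. Qed.

Lemma r_nat x x' (f : x ~> x') : r_ x' ∘ (f ⊞ idm r0) = f ∘ r_ x.
Proof. exact: runit_nat. Qed.

Lemma a'_nat x x' y y' z z' (f : x ~> x') (g : y ~> y') (h : z ~> z') :
  a'_ x' y' z' ∘ (f ⊠ (g ⊠ h)) = ((f ⊠ g) ⊠ h) ∘ a'_ x y z.
Proof. exact: assoc_nat. Qed.

Lemma l'_nat x x' (f : x ~> x') : l'_ x' ∘ (idm r1 ⊠ f) = f ∘ l'_ x.
Proof. exact: lunit_nat. Qed.

Lemma r'_nat x x' (f : x ~> x') : r'_ x' ∘ (f ⊠ idm r1) = f ∘ r'_ x.
Proof. exact: runit_nat. Qed.

Lemma c_nat x x' y y' (f : x ~> x') (g : y ~> y') :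
  c_ x' y' ∘ (f ⊞ g) = (g ⊞ f) ∘ c_ x y.
Proof. exact: braid_nat. Qed.

Lemma c_K x y : c_ y x ∘ c_ x y = idm (x ⊕ y).
Proof. exact: braidK. Qed.

Lemma a_pentagon x y z t :
  a_ (x ⊕ y) z t ∘ a_ x y (z ⊕ t)
  = (a_ x y z ⊞ idm t) ∘ a_ x (y ⊕ z) t ∘ (idm x ⊞ a_ y z t).
Proof. exact: pentagon. Qed.

Lemma c_hexagon x y z :
  a_ z x y ∘ c_ (x ⊕ y) z ∘ a_ x y z
  = (c_ x z ⊞ idm y) ∘ a_ x z y ∘ (idm x ⊞ c_ y z).
Proof. exact: hexagon. Qed.

Lemma raddm_split x x' y y' (f : x ~> x') (g : y ~> y') :
  f ⊞ g = (f ⊞ idm y') ∘ (idm x ⊞ g).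
Proof. by rewrite -raddm_comp comp1m compm1. Qed.

Lemma rmulm_split x x' y y' (f : x ~> x') (g : y ~> y') :
  f ⊠ g = (f ⊠ idm y') ∘ (idm x ⊠ g).
Proof. by rewrite -rmulm_comp comp1m compm1. Qed.

Lemma raddm1l x y y' y'' (f : y' ~> y'') (g : y ~> y') :
  idm x ⊞ f ∘ g = (idm x ⊞ f) ∘ (idm x ⊞ g).
Proof. by rewrite -raddm_comp comp1m. Qed.

Lemma raddm_compl x x' x'' y y' (f' : x' ~> x'') (f : x ~> x') (g : y ~> y') :
  (f' ∘ f) ⊞ g = (f' ⊞ idm y') ∘ (f ⊞ g).
Proof. by rewrite -raddm_comp comp1m. Qed.

Lemma raddm_compr x x' y y' y'' (f : x ~> x') (g' : y' ~> y'') (g : y ~> y') :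
  f ⊞ (g' ∘ g) = (idm x' ⊞ g') ∘ (f ⊞ g).
Proof. by rewrite -raddm_comp comp1m. Qed.

Lemma rmulm_compl x x' x'' y y' (f' : x' ~> x'') (f : x ~> x') (g : y ~> y') :
  (f' ∘ f) ⊠ g = (f' ⊠ idm y') ∘ (f ⊠ g).
Proof. by rewrite -rmulm_comp comp1m. Qed.

Lemma rmulm_compr x x' y y' y'' (f : x ~> x') (g' : y' ~> y'') (g : y ~> y') :
  f ⊠ (g' ∘ g) = (idm x' ⊠ g') ∘ (f ⊠ g).
Proof. by rewrite -rmulm_comp comp1m. Qed.

(** * Exchanging two summands *)

(** Locked: otherwise rewriting with [compmA] would see through it. *)
Definition swap x y z : x ⊕ (y ⊕ z) ~> y ⊕ (x ⊕ z) :=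
  locked (isoi (a_ y x z) ∘ (c_ x y ⊞ idm z) ∘ a_ x y z).

Lemma swapE x y z :
  swap x y z = isoi (a_ y x z) ∘ (c_ x y ⊞ idm z) ∘ a_ x y z.
Proof. by rewrite /swap -lock. Qed.

Lemma a_swap x y z : a_ y x z ∘ swap x y z = (c_ x y ⊞ idm z) ∘ a_ x y z.
Proof. by rewrite swapE -compmA compKVm. Qed.

Lemma swap_nat x x' y y' z z' (f : x ~> x') (g : y ~> y') (h : z ~> z') :
  swap x' y' z' ∘ (f ⊞ (g ⊞ h)) = (g ⊞ (f ⊞ h)) ∘ swap x y z.
Proof.
apply: (iso_monic (f := a_ y' x' z')).
rewrite !compmA a_swap a_nat -!compmA a_swap a_nat !compmA -!raddm_comp c_nat.
by rewrite comp1m compm1.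
Qed.

Lemma swapK x y z : swap y x z ∘ swap x y z = idm (x ⊕ (y ⊕ z)).
Proof.
rewrite !swapE !compmA compmK -(compmA _ (_ ⊞ _) (_ ⊞ _)) -raddm_comp c_K comp1m.
by rewrite raddm_id compm1 isoK.
Qed.

(** Moving a sum [x ⊕ y] past [z] is moving [y] and then [x] past it: this is
    the hexagon, with a spectator [w] on the right. *)
Lemma swap_addl x y z w :
  (idm z ⊞ a_ x y w) ∘ swap x z (y ⊕ w) ∘ (idm x ⊞ swap y z w)
  = swap (x ⊕ y) z w ∘ a_ x y (z ⊕ w).
Proof.
apply: (iso_monic (f := a_ z (x ⊕ y) w)).
apply: (iso_monic (f := radd_iso (a_ z x y) (iso_id w))) => /=.
rewrite !compmA -a_pentagon.
rewrite -(compmA (a_ _ _ _) (a_ _ _ _) (swap _ _ _)) a_swap compmA.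
rewrite -(raddm_id y w) a_nat.
rewrite -(compmA _ (a_ (x ⊕ z) y w)) a_pentagon !compmA.
rewrite -(compmA _ (idm x ⊞ a_ _ _ _)) -(raddm_comp (idm x)) a_swap comp1m.
rewrite -[in X in _ ∘ (X ⊞ _)](comp1m (idm x)) raddm_comp !compmA.
rewrite -(compmA _ (a_ x (z ⊕ y) w)) a_nat !compmA.
rewrite -(compmA _ (a_ z (x ⊕ y) w)) a_swap !compmA.
rewrite -(compmA _ (a_ (x ⊕ y) z w)) a_pentagon !compmA.
by rewrite -!raddm_comp !comp1m c_hexagon.
Qed.

(** Both sides reverse [x ⊕ (y ⊕ z)] in front of [w]; by [swap_addl] they differ
    by the naturality of moving [z] past [c_ x y]. *)
Lemma swap_braid x y z w :
  (idm z ⊞ swap x y w) ∘ swap x z (y ⊕ w) ∘ (idm x ⊞ swap y z w)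
  = swap y z (x ⊕ w) ∘ (idm y ⊞ swap x z w) ∘ swap x y (z ⊕ w).
Proof.
apply: (iso_monic (f := radd_iso (iso_id z) (a_ y x w))) => /=.
rewrite !compmA swap_addl -(compmA _ (a_ _ _ _)) a_swap.
rewrite -raddm_comp a_swap comp1m -[in X in X ⊞ _](comp1m (idm z)) raddm_comp.
rewrite -!(compmA (idm z ⊞ (_ ⊞ _))) swap_addl !compmA -swap_nat.
by rewrite raddm_id.
Qed.

End RigIso.

(** * Generating the permutations *)

Lemma finbij_card m n : finbij m n -> m = n.
Proof. by case=> f /bij_eq_card; rewrite !card_ord. Qed.

Lemma finbij_compE m n p (g : finbij n p) (f : finbij m n) k :
  finbij_comp g f k = g (f k).
Proof. by []. Qed.

(** [n.+1] is read as [1 + n] throughout, which holds by computation; the first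
    element is the one that [fin1] fixes. *)
Definition fin1 n p (f : finbij n p) : finbij n.+1 p.+1 :=
  finadd (finbij_id 1) f.

Definition fswap n : finbij n.+2 n.+2 := swap (S := FSet_sk) 1 1 n.

Lemma ord0_lshift n : ord0 = lshift n (ord0 : 'I_1) :> 'I_n.+1.
Proof. exact: val_inj. Qed.

Lemma lift0_rshift n (j : 'I_n) : lift ord0 j = rshift 1 j.
Proof. exact: val_inj. Qed.

Lemma fin1_0 n p (f : finbij n p) : fin1 f ord0 = ord0.
Proof. by rewrite {1}ord0_lshift [LHS]ordaddL -ord0_lshift. Qed.

Lemma fin1_lift n p (f : finbij n p) j : fin1 f (lift ord0 j) = lift ord0 (f j).
Proof. by rewrite lift0_rshift [LHS]ordaddR -lift0_rshift. Qed.

Lemma ord_liftP n (P : 'I_n.+1 -> Prop) :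
  P ord0 -> (forall j, P (lift ord0 j)) -> forall i, P i.
Proof. by move=> P0 P1 i; case: (unliftP ord0 i) => [j|] ->. Qed.

Lemma fswap_0 n : fswap n ord0 = lift ord0 ord0.
Proof.
rewrite /fswap swapE /= /finfn /=.
have -> : ord0 = lshift (1 + n) (ord0 : 'I_1) :> 'I_(1 + (1 + n)).
  exact: val_inj.
by rewrite !ordE; apply: val_inj.
Qed.

Lemma fswap_1 n : fswap n (lift ord0 ord0) = ord0.
Proof.
rewrite /fswap swapE /= /finfn /=.
have -> : lift ord0 ord0 = rshift 1 (lshift n (ord0 : 'I_1)) by exact: val_inj.
by rewrite !ordE; apply: val_inj.
Qed.

Lemma fswap_2 n (j : 'I_n) :
  fswap n (lift ord0 (lift ord0 j)) = lift ord0 (lift ord0 j).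
Proof.
rewrite /fswap swapE /= /finfn /=.
have -> : lift ord0 (lift ord0 j) = rshift 1 (rshift 1 j) by exact: val_inj.
by rewrite !ordE.
Qed.

Lemma fswapK n : finbij_comp (fswap n) (fswap n) = finbij_id n.+2.
Proof. exact: (@swapK FSet_sk 1 1 n). Qed.

(** The bijection that [f] induces from the complement of [0] to the complement
    of [f 0], both renumbered in increasing order. *)
Definition rest_fun m n (f : 'I_m.+1 -> 'I_n.+1) (e : m = n) (j : 'I_m) :
  'I_n :=
  (* [unlift] succeeds when [f] is injective. *)
  odflt (cast_ord e j) (unlift (f ord0) (f (lift ord0 j))).

Lemma lift_rest_fun m n (f : finbij m.+1 n.+1) e j :
  lift (f ord0) (rest_fun f e j) = f (lift ord0 j).
Proof.
rewrite /rest_fun; case: unliftP => [i ->//|/(bij_inj (svalP f))].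
by move/eqP; rewrite eq_sym (negPf (neq_lift _ _)).
Qed.

Lemma rest_subproof m n (f : finbij m.+1 n.+1) e : bijective (rest_fun f e).
Proof.
apply: inj_card_bij; last by rewrite !card_ord e.
move=> i j eij; apply: (@lift_inj _ ord0); apply: (bij_inj (svalP f)).
by rewrite -[LHS](lift_rest_fun f e) -[RHS](lift_rest_fun f e) eij.
Qed.

Definition rest m n (f : finbij m.+1 n.+1) : finbij m n :=
  exist _ _ (rest_subproof f (succn_inj (finbij_card f))).

Lemma lift_rest m n (f : finbij m.+1 n.+1) j :
  lift (f ord0) (rest f j) = f (lift ord0 j).
Proof. exact: lift_rest_fun. Qed.

Lemma rest_uniq m n (f : finbij m.+1 n.+1) (g : finbij m n) :
  (forall j, lift (f ord0) (g j) = f (lift ord0 j)) -> rest f = g.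
Proof.
by move=> fg; apply: finbij_eq => j; apply: (@lift_inj _ (f ord0));
  rewrite lift_rest.
Qed.

(** Insertion of [0] at position [k], as a product of swaps: exchange the first
    two elements, then insert [0] at position [k.-1] among the elements after
    the first one. *)
Fixpoint fins k n : finbij n.+1 n.+1 :=
  match k, n with
  | k.+1, n.+1 => finbij_comp (fin1 (fins k n)) (fswap n)
  | _, _ => finbij_id _
  end.

Lemma fins_spec k n : k <= n ->
  (fins k n ord0 = k :> nat) /\
  (forall j, fins k n (lift ord0 j) = bump k j :> nat).
Proof.
elim: k n => [|k IH] [|n] // /IH [f0 fj]; rewrite /fins -/fins.
split; first by rewrite finbij_compE fswap_0 fin1_lift /= f0.
elim/ord_liftP => [|j]; rewrite finbij_compE.
  by rewrite fswap_1 fin1_0.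
by rewrite fswap_2 fin1_lift [RHS]/= /bump leq0n /= fj /bump !add1n ltnS addnS.
Qed.

Lemma fins_rest m n (f : finbij m.+1 n.+1) :
  f = finbij_comp (fins (f ord0) n) (fin1 (rest f)).
Proof.
have [g0 gj] := fins_spec (leq_ord (f ord0)).
apply: finbij_eq; elim/ord_liftP => [|j]; apply: val_inj.
  by rewrite finbij_compE fin1_0; apply: esym.
rewrite finbij_compE fin1_lift; apply: etrans (esym (gj _)).
by rewrite -lift_rest.
Qed.

(** By [fins_rest] a bijection is some [fin1 g] followed by an insertion, and
    insertions are products of swaps. *)
Lemma perm_ind (P : forall m n, finbij m n -> Prop) :
  (forall n, P n n (finbij_id n)) ->
  (forall m n p (g : finbij n p) (f : finbij m n),
     P _ _ g -> P _ _ f -> P _ _ (finbij_comp g f)) ->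
  (forall m n (f : finbij m n), P _ _ f -> P _ _ (fin1 f)) ->
  (forall n, P _ _ (fswap n)) ->
  forall m n (f : finbij m n), P _ _ f.
Proof.
move=> Pid Pcomp Pfin1 Pswap; elim=> [|m IH] [|n] f.
- by have -> : f = finbij_id 0; [apply: finbij_eq; case|apply: Pid].
- by have := finbij_card f.
- by have := finbij_card f.
rewrite (fins_rest f); apply: (Pcomp); last exact/Pfin1/IH.
move: (nat_of_ord _) => k; elim: k n {f} => [|k IHk] [|n] //=; try exact: Pid.
by apply: (Pcomp) => //; apply: (Pfin1).
Qed.

(** * Permutations acting on a sum of units *)

Lemma lift_val n (h : 'I_n) i : lift h i = bump h i :> nat.
Proof. by []. Qed.

Lemma bump_unbump k l i : k != l ->
  bump l (bump (unbump l k) i) = bump k (bump (unbump k l) i).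
Proof. rewrite /bump /unbump; lia. Qed.

Section PermAction.
Variable S : rig_data.

(** Bracketed to the right and ending in [r0], unlike [nfold], so that
    [unary n.+1] is [r1 ⊕ unary n] by computation, as [n.+1] is [1 + n]. *)
Fixpoint unary n : S := if n is m.+1 then r1 ⊕ unary m else r0.

(** The counterpart of [fins] on sums of units. *)
Fixpoint ins k n : unary n.+1 ~> unary n.+1 :=
  match k, n with
  | k.+1, n.+1 => (idm r1 ⊞ ins k n) ∘ swap r1 r1 (unary n)
  | _, _ => idm _
  end.

Lemma ins0 n : ins 0 n = idm (unary n.+1).
Proof. by case: n. Qed.

Lemma insS k n :
  ins k.+1 n.+1 = (idm r1 ⊞ ins k n) ∘ swap r1 r1 (unary n).
Proof. by []. Qed.

(** Inserting two new summands in either order gives the same result, once they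
    have been exchanged. Moving one step further in both insertions exchanges
    each of the two with the same third summand; [swap_braid] compares the two
    ways of doing so. *)
Lemma ins_ins k l n : k <= l -> l <= n ->
  ins k n.+1 ∘ (idm r1 ⊞ ins l n)
  = ins l.+1 n.+1 ∘ (idm r1 ⊞ ins k n) ∘ swap r1 r1 (unary n).
Proof.
elim: k l n => [|k IH] l n.
  by move=> _ _; rewrite !ins0 insS comp1m raddm_id compm1 -compmA swapK compm1.
case: l n => [|l] [|n] // kl ln.
rewrite (insS k n.+1) (insS l n) (insS k n) !raddm1l (insS l.+1 n.+1) !compmA.
rewrite -(compmA _ (swap _ _ _) (idm r1 ⊞ (idm r1 ⊞ ins l n))) swap_nat compmA.
rewrite -raddm1l IH // 2!raddm1l.
rewrite -(compmA _ (swap _ _ _) (idm r1 ⊞ (idm r1 ⊞ ins k n))) swap_nat compmA.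
rewrite -(compmA _ (swap _ _ _) (idm r1 ⊞ swap _ _ _)).
rewrite -!compmA; congr (_ ∘ (_ ∘ _)); rewrite !compmA.
exact: (swap_braid r1 r1 r1 (unary n)).
Qed.

(** The recursion is on both sizes, so that no cast along [m = n] is needed: the
    cases of different sizes are absurd. *)
Fixpoint act m n : finbij m n -> (unary m ~> unary n) :=
  match m, n with
  | 0, 0 => fun _ => idm _
  | m.+1, n.+1 => fun f => ins (f ord0) n ∘ (idm r1 ⊞ act (rest f))
  | m.+1, 0 => fun f => False_rect _ (O_S _ (esym (finbij_card f)))
  | 0, n.+1 => fun f => False_rect _ (O_S _ (finbij_card f))
  end.

Lemma actS m n (f : finbij m.+1 n.+1) :
  act f = ins (f ord0) n ∘ (idm r1 ⊞ act (rest f)).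
Proof. by []. Qed.

Lemma act_id n : act (finbij_id n) = idm (unary n).
Proof.
elim: n => // n IH; rewrite actS ins0 comp1m.
by rewrite (rest_uniq (g := finbij_id n)) // IH raddm_id.
Qed.

Lemma rest_fin1 m n (f : finbij m n) : rest (fin1 f) = f.
Proof. by apply: rest_uniq => j; rewrite fin1_0 fin1_lift. Qed.

Lemma rest_comp_fin1 m n p (g : finbij n.+1 p.+1) (f : finbij m n) :
  rest (finbij_comp g (fin1 f)) = finbij_comp (rest g) f.
Proof.
apply: rest_uniq => j.
by rewrite !finbij_compE fin1_0 fin1_lift -lift_rest.
Qed.

Lemma act_fin1 m n (f : finbij m n) : act (fin1 f) = idm r1 ⊞ act f.
Proof. by rewrite actS rest_fin1 fin1_0 ins0 comp1m. Qed.

Lemma act_comp_fin1 m n p (g : finbij n.+1 p.+1) (f : finbij m n) :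
  (forall g' : finbij n p, act (finbij_comp g' f) = act g' ∘ act f) ->
  act (finbij_comp g (fin1 f)) = act g ∘ act (fin1 f).
Proof.
move=> gf; rewrite actS rest_comp_fin1 finbij_compE fin1_0 gf act_fin1.
by rewrite raddm1l compmA.
Qed.

Lemma rest_0 n p (g : finbij n.+2 p.+2) :
  rest g ord0 = unbump (g ord0) (g (lift ord0 ord0)) :> nat.
Proof. by rewrite -lift_rest /= bumpK. Qed.

(** Removing the first two inputs leaves the same bijection in either order. *)
Lemma rest_rest_swap n p (g : finbij n.+2 p.+2) :
  rest (rest (finbij_comp g (fswap n))) = rest (rest g).
Proof.
apply: rest_uniq => j; set h := finbij_comp g (fswap n).
have h0 : h ord0 = g (lift ord0 ord0) by rewrite finbij_compE fswap_0.
have h1 : h (lift ord0 ord0) = g ord0 by rewrite finbij_compE fswap_1.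
apply: (@lift_inj _ (h ord0)); rewrite lift_rest.
have -> : h (lift ord0 (lift ord0 j)) = g (lift ord0 (lift ord0 j)).
  by rewrite finbij_compE fswap_2.
rewrite -!lift_rest; apply: ord_inj; rewrite 4!lift_val !rest_0 h0 h1.
apply: bump_unbump; apply/eqP => /val_inj /(bij_inj (svalP g)).
by apply/eqP.
Qed.

(** The heart of functoriality. Write [k] and [l] for the images of the first two
    elements under [g]. If [k < l], the two actions insert at [k] after [l.-1],
    and at [l] after [k], respectively, so [ins_ins] applies. Otherwise, exchange
    the roles of [g] and of its composite with the swap, which is involutive. *)
Lemma act_comp_swap n p (g : finbij n.+2 p.+2) :
  act (finbij_comp g (fswap n)) = act g ∘ swap r1 r1 (unary n).
Proof.
wlog lt_g : g / g ord0 < g (lift ord0 ord0).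
  move=> wl; case: (ltngtP (g ord0) (g (lift ord0 ord0))) => [|lt_g|/val_inj].
  - exact: wl.
  - have := wl (finbij_comp g (fswap n)).
    rewrite !finbij_compE fswap_0 fswap_1 => /(_ lt_g).
    have -> : finbij_comp (finbij_comp g (fswap n)) (fswap n) = g.
      apply: finbij_eq => k.
      by rewrite 2!finbij_compE -[fswap n _]finbij_compE fswapK.
    by move=> ->; rewrite -compmA swapK compm1.
  - by move=> /(bij_inj (svalP g)).
rewrite !actS rest_rest_swap !rest_0 !finbij_compE fswap_0 fswap_1.
move: (rest (rest g)) => r.
have le_l := leq_ord (g (lift ord0 ord0)).
have -> : unbump (g (lift ord0 ord0)) (g ord0) = g ord0.
  by rewrite /unbump ltnNge (ltnW lt_g) subn0.
have -> : unbump (g ord0) (g (lift ord0 ord0)) = (g (lift ord0 ord0)).-1.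
  by rewrite /unbump lt_g subn1.
case: (nat_of_ord (g (lift _ _))) lt_g le_l => // l lt_g le_l /=.
rewrite !raddm1l !compmA ins_ins //.
rewrite -2!(compmA (ins l.+1 p.+1 ∘ _)) (swap_nat (idm r1) (idm r1) (act r)).
by rewrite -(compmA (idm r1 ⊞ (idm r1 ⊞ act r))) swapK compm1.
Qed.

Lemma act_swap n : act (fswap n) = swap r1 r1 (unary n).
Proof.
have := act_comp_swap (finbij_id n.+2); rewrite act_id comp1m => <-.
by congr act; apply: finbij_eq.
Qed.

Lemma act_comp m n p (g : finbij n p) (f : finbij m n) :
  act (finbij_comp g f) = act g ∘ act f.
Proof.
elim/perm_ind: f p g => {m n} [n|m n q g f IHg IHf|m n f IH|n] p h.
- have -> : finbij_comp h (finbij_id n) = h by apply: finbij_eq.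
  by rewrite act_id compm1.
- rewrite IHf compmA -IHg -IHf; congr act; exact: finbij_eq.
- by case: p h => [|p] h; [have := finbij_card h | apply: act_comp_fin1].
- case: p h => [|[|p]] h; try by have := finbij_card h.
  by rewrite act_comp_swap act_swap.
Qed.

Definition act_functor : functor FSet_cat S :=
  @Functor FSet_cat S unary act act_id
    (fun _ _ _ g f => act_comp g f).

End PermAction.

(** * Equality of morphisms up to equality of objects *)

(** In a strict setting most laws hold between morphisms whose objects are equal
    without being convertible. [heq] states them without casts; [heq_eq] goes
    back to plain equality when the objects agree. *)
Inductive heq (C : category) (x y : C) (f : x ~> y) :
  forall x' y' : C, (x' ~> y') -> Prop := heq_refl : heq f f.
Notation "f ≡ g" := (heq f g) (at level 70, no associativity).

Section Heq.
Variable C : category.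

Lemma heq_objs (x y x' y' : C) (f : x ~> y) (g : x' ~> y') :
  f ≡ g -> x = x' /\ y = y'.
Proof. by case. Qed.

Lemma heq_eq (x y : C) (f g : x ~> y) : f ≡ g -> f = g.
Proof.
suff H x' y' (h : x' ~> y') : f ≡ h -> forall (ex : x' = x) (ey : y' = y),
    f = ecast y (x ~> y) ey (ecast x (x ~> y') ex h).
  by move=> fg; rewrite (H _ _ _ fg erefl erefl).
by case=> ex ey; rewrite (Prop_irrelevance ex erefl) (Prop_irrelevance ey erefl).
Qed.

Lemma heq_of_eq (x y : C) (f g : x ~> y) : f = g -> f ≡ g.
Proof. by move->. Qed.

Lemma heq_sym (x y x' y' : C) (f : x ~> y) (g : x' ~> y') : f ≡ g -> g ≡ f.
Proof. by case. Qed.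

Lemma heq_trans (x y x' y' x'' y'' : C) (g : x' ~> y') (f : x ~> y)
  (h : x'' ~> y'') : f ≡ g -> g ≡ h -> f ≡ h.
Proof. by case. Qed.

Lemma heq_comp (x y z x' y' z' : C) (g : y ~> z) (f : x ~> y)
    (g' : y' ~> z') (f' : x' ~> y') :
  g ≡ g' -> f ≡ f' -> g ∘ f ≡ g' ∘ f'.
Proof.
move=> gg ff; have [ex ey] := heq_objs ff; have [_ ez] := heq_objs gg.
case: _ / ex f' ff => f'; case: _ / ey f' g' gg => f' g'.
by case: _ / ez g' => g' /heq_eq -> /heq_eq ->.
Qed.

Lemma heq_iso_inv (x y x' y' : C) (f : iso x y) (g : iso x' y') :
  f ≡ g -> isoi f ≡ isoi g.
Proof.
move=> fg; have [ex ey] := heq_objs fg.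
case: _ / ex g fg => g; case: _ / ey g => g /heq_eq /iso_eq ->; exact: heq_refl.
Qed.

Lemma heq_id (x y : C) : x = y -> idm x ≡ idm y.
Proof. by case: _ /. Qed.

Lemma is_identity_heq (x y : C) (f : x ~> y) : is_identity f -> idm x ≡ f.
Proof. by case. Qed.

Lemma heq_is_identity (x y x' y' : C) (f : x ~> y) (g : x' ~> y') :
  f ≡ g -> is_identity f -> is_identity g.
Proof. by case. Qed.

Lemma is_identity_eq (x y : C) (f g : x ~> y) :
  is_identity f -> is_identity g -> f = g.
Proof.
move=> /is_identity_heq f1 /is_identity_heq g1.
exact/heq_eq/(heq_trans (heq_sym f1)).
Qed.

Lemma is_identity_id (x : C) : is_identity (idm x).
Proof. by []. Qed.

Lemma is_identity_obj (x y : C) (f : x ~> y) : is_identity f -> x = y.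
Proof. by case. Qed.

Lemma is_identity_comp (x y z : C) (g : y ~> z) (f : x ~> y) :
  is_identity g -> is_identity f -> is_identity (g ∘ f).
Proof. by case=> /[dup] /is_identity_heq f1; rewrite comp1m. Qed.

Lemma heq_compl (x y z : C) (g : y ~> z) (f : x ~> y) :
  is_identity g -> g ∘ f ≡ f.
Proof. by case; rewrite comp1m. Qed.

Lemma heq_compr (x y z : C) (g : y ~> z) (f : x ~> y) :
  is_identity f -> g ∘ f ≡ g.
Proof. by move=> f1; case: _ / f1 g => g; rewrite compm1. Qed.

Definition eq_iso (x y : C) (e : x = y) : iso x y :=
  ecast y (iso x y) e (iso_id x).

Lemma eq_iso_identity (x y : C) (e : x = y) : is_identity (eq_iso e).
Proof. by case: _ / e; apply: is_identity_id. Qed.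

End Heq.

Lemma fmap_heq (C D : category) (F : functor C D) (x y x' y' : C)
  (f : x ~> y) (g : x' ~> y') : f ≡ g -> fmap F f ≡ fmap F g.
Proof. by case. Qed.

Lemma fmap_identity (C D : category) (F : functor C D) (x y : C) (f : x ~> y) :
  is_identity f -> is_identity (fmap F f).
Proof. by case; rewrite fmap_id; apply: is_identity_id. Qed.

Definition fmap_iso (C D : category) (F : functor C D) (x y : C) (f : iso x y) :
  iso (F x) (F y).
Proof.
by exists (fmap F f) (fmap F (isoi f)); rewrite -fmap_comp (isoK, isoKi) fmap_id.
Defined.

Lemma fmap_isoE (C D : category) (F : functor C D) (x y : C) (f : iso x y) :
  isof (fmap_iso F f) = fmap F f.
Proof. by []. Qed.

Lemma raddm_heq (S : rig_data) (x y z w x' y' z' w' : S) (f : x ~> y)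
  (g : z ~> w) (f' : x' ~> y') (g' : z' ~> w') :
  f ≡ f' -> g ≡ g' -> f ⊞ g ≡ f' ⊞ g'.
Proof. by case; case. Qed.

Lemma rmulm_heq (S : rig_data) (x y z w x' y' z' w' : S) (f : x ~> y)
  (g : z ~> w) (f' : x' ~> y') (g' : z' ~> w') :
  f ≡ f' -> g ≡ g' -> f ⊠ g ≡ f' ⊠ g'.
Proof. by case; case. Qed.

Lemma raddm_identity (S : rig_data) (x y z w : S) (f : x ~> y) (g : z ~> w) :
  is_identity f -> is_identity g -> is_identity (f ⊞ g).
Proof. by case; case; rewrite raddm_id; apply: is_identity_id. Qed.

Lemma rmulm_identity (S : rig_data) (x y z w : S) (f : x ~> y) (g : z ~> w) :
  is_identity f -> is_identity g -> is_identity (f ⊠ g).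
Proof. by case; case; rewrite rmulm_id; apply: is_identity_id. Qed.

(** Naturality of a family of identities says that the two morphisms agree: this
    turns the axioms about structural isomorphisms into strict laws. *)
Lemma heq_nat (C : category) (x x' y y' : C) (f : x ~> y) (g : x' ~> y')
    (i : x ~> x') (j : y ~> y') :
  is_identity i -> is_identity j -> j ∘ f = g ∘ i -> f ≡ g.
Proof.
move=> i1 j1 e; apply: heq_trans (heq_sym (heq_compl f j1)) _; rewrite e.
exact: heq_compr.
Qed.

Lemma nat_heq (C : category) (x x' y y' : C) (f : x ~> y) (g : x' ~> y')
    (i : x ~> x') (j : y ~> y') :
  is_identity i -> is_identity j -> f ≡ g -> j ∘ f = g ∘ i.
Proof.
move=> i1 j1 fg; apply: heq_eq; apply: heq_trans (heq_compl f j1) _.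
exact: heq_trans fg (heq_sym (heq_compr g i1)).
Qed.

(** * Left semistrict rig categories *)

Section Strict.
Variables (S : rigcat) (hS : left_semistrict S).
Implicit Types x y z w : S.

Lemma strict_addA x x' y y' z z' (f : x ~> x') (g : y ~> y') (h : z ~> z') :
  f ⊞ (g ⊞ h) ≡ (f ⊞ g) ⊞ h.
Proof. exact: heq_nat (strict_a hS _ _ _) (strict_a hS _ _ _) (a_nat f g h). Qed.

Lemma strict_add0 x x' (f : x ~> x') : idm r0 ⊞ f ≡ f.
Proof. exact: heq_nat (strict_l hS _) (strict_l hS _) (l_nat f). Qed.

Lemma strict_addn0 x x' (f : x ~> x') : f ⊞ idm r0 ≡ f.
Proof. exact: heq_nat (strict_r hS _) (strict_r hS _) (r_nat f). Qed.

Lemma strict_muln1 x x' (f : x ~> x') : f ⊠ idm r1 ≡ f.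
Proof. exact: heq_nat (strict_r' hS _) (strict_r' hS _) (r'_nat f). Qed.

Lemma strict_muln0 x x' (f : x ~> x') : f ⊠ idm r0 ≡ idm (r0 : S).
Proof.
apply: heq_nat (strict_n hS x) (strict_n hS x') _.
by rewrite (rig_n_nat (rigcat_axioms S)) comp1m.
Qed.

Lemma strict_mulDr x x' y y' z z' (f : x ~> x') (g : y ~> y') (h : z ~> z') :
  f ⊠ (g ⊞ h) ≡ (f ⊠ g) ⊞ (f ⊠ h).
Proof.
apply: heq_nat (strict_d hS _ _ _) (strict_d hS _ _ _) _.
exact: rig_d_nat (rigcat_axioms S) _ _ _ _ _ _ f g h.
Qed.

Lemma strict_mulc x y z : idm x ⊠ c_ y z ≡ c_ (x ⊗ y) (x ⊗ z).
Proof.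
apply: heq_nat (strict_d hS _ _ _) (strict_d hS _ _ _) _.
exact: rig2 (rigcat_axioms S) _ _ _.
Qed.

Lemma strict_swap x y z : swap x y z ≡ c_ x y ⊞ idm z.
Proof.
exact: heq_nat (strict_a hS _ _ _) (strict_a hS _ _ _) (a_swap x y z).
Qed.

Lemma strict_swap_add x y z w : swap x y z ⊞ idm w ≡ swap x y (z ⊕ w).
Proof.
apply: heq_trans (raddm_heq (strict_swap _ _ _) (heq_refl (idm w))) _.
apply: heq_trans (heq_sym (strict_addA _ _ _)) _.
by rewrite raddm_id; apply: heq_sym; apply: strict_swap.
Qed.

Lemma strict_mul_swap x y z w :
  idm x ⊠ swap y z w ≡ c_ (x ⊗ y) (x ⊗ z) ⊞ idm (x ⊗ w).
Proof.
apply: heq_trans (rmulm_heq (heq_refl (idm x)) (strict_swap y z w)) _.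
apply: heq_trans (strict_mulDr _ _ _) _; rewrite rmulm_id.
exact: raddm_heq (strict_mulc _ _ _) (heq_refl _).
Qed.

Lemma c_inv x y : isoi (c_ x y) = c_ y x.
Proof. by rewrite -[LHS]comp1m -(c_K x y) compmK. Qed.

Lemma strict_c_addl x y z :
  (c_ x z ⊞ idm y) ∘ a_ x z y ∘ (idm x ⊞ c_ y z) ≡ c_ (x ⊕ y) z.
Proof.
rewrite -c_hexagon; apply: heq_trans (heq_compr _ (strict_a hS _ _ _)) _.
exact: heq_compl (strict_a hS _ _ _).
Qed.

Lemma heq_c x y x' y' : x = x' -> y = y' -> c_ x y ≡ c_ x' y'.
Proof. by do 2!case: _ /. Qed.

(** By the hexagon for [r0], [r0] and [x], the isomorphism [c_ r0 x] is
    idempotent once its source and target are both read as [x]. *)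
Lemma is_identity_c0 x : is_identity (c_ (r0 : S) x).
Proof.
have [i ci] : exists i : iso x x, c_ r0 x ≡ i.
  have := is_identity_obj (strict_l hS x).
  have := is_identity_obj (strict_r hS x).
  move: (c_ r0 x); rewrite -/(r0 ⊕ x) /= => j e1 e2.
  by move: j; rewrite e1 e2 => j; exists j; apply: heq_refl.
have ii : i ∘ i ≡ i.
  have h1 : (c_ r0 x ⊞ idm r0) ∘ a_ r0 x r0 ∘ (idm r0 ⊞ c_ r0 x) ≡ i ∘ i.
    apply: heq_comp; last exact: heq_trans (strict_add0 _) ci.
    apply: heq_trans (heq_compr _ (strict_a hS _ _ _)) _.
    exact: heq_trans (strict_addn0 _) ci.
  apply: heq_trans (heq_sym h1) (heq_trans (strict_c_addl r0 r0 x) _).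
  by apply: heq_trans ci; apply: heq_c => //;
    apply: is_identity_obj (strict_l hS _).
apply: heq_is_identity (heq_sym ci) _; have := heq_eq ii.
rewrite -[X in _ = X]compm1 => /iso_monic ->; exact: is_identity_id.
Qed.

(** The map [v_] as an isomorphism, to be inverted in [d'_addr]. *)
Definition v_iso x y z w : iso ((x ⊕ y) ⊕ (z ⊕ w)) ((x ⊕ z) ⊕ (y ⊕ w)) :=
  iso_comp (iso_comp (iso_comp (iso_comp
    (a_ x z (y ⊕ w))
    (radd_iso (iso_id x) (iso_inv (a_ z y w))))
    (radd_iso (iso_id x) (radd_iso (c_ y z) (iso_id w))))
    (radd_iso (iso_id x) (a_ y z w)))
    (iso_inv (a_ x y (z ⊕ w))).

Lemma is_identity_d'0 x y : is_identity (d'_ x y r0).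
Proof.
have := strict_n hS (x ⊕ y); rewrite -(rig7_0 (rigcat_axioms S)).
apply: heq_is_identity; apply: heq_compl; apply: is_identity_comp.
  exact: strict_l.
by apply: raddm_identity; apply: strict_n.
Qed.

Lemma is_identity_d'1 x y : is_identity (d'_ x y r1).
Proof.
have := strict_r' hS (x ⊕ y); rewrite -(rig8' (rigcat_axioms S)).
apply: heq_is_identity; apply: heq_compl.
by apply: raddm_identity; apply: strict_r'.
Qed.

(** The axiom on the two ways of expanding a product of two sums, solved for the
    right distributor: at a sum it is determined by the commutator and by its
    values at the summands. *)
Lemma d'_addr x y z w :
  d'_ x y (z ⊕ w)
  = isoi (radd_iso (d_ x z w) (d_ y z w))
    ∘ (isoi (v_iso (x ⊗ z) (x ⊗ w) (y ⊗ z) (y ⊗ w))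
       ∘ ((d'_ x y z ⊞ d'_ x y w) ∘ d_ (x ⊕ y) z w)) :> (_ ~> _).
Proof. by rewrite -(rig7 (rigcat_axioms S)) -!compmA !compKm. Qed.

Lemma unary_add m n : unary S (m + n) = unary S m ⊕ unary S n.
Proof.
elim: m => [|m IH] /=; first by rewrite (is_identity_obj (strict_l hS _)).
by rewrite addnE /= -addnE IH; apply: is_identity_obj (strict_a hS _ _ _).
Qed.

Lemma unary1 : unary S 1 = r1.
Proof. exact: is_identity_obj (strict_r hS _). Qed.

Lemma unary_mul m n : unary S (m * n) = unary S m ⊗ unary S n.
Proof.
elim: n => [|n IH].
  by rewrite muln0 (is_identity_obj (strict_n hS _)).
rewrite mulnS unary_add IH [RHS](is_identity_obj (strict_d hS _ _ _)).
by rewrite (is_identity_obj (strict_r' hS _)).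
Qed.

End Strict.

(** * The action respects the structure *)

Section StrictAction.
Variables (S : rigcat) (hS : left_semistrict S).
Implicit Types x y z w : S.

Let G := act_functor S.
Implicit Types m n p q : FSet_sk.

(** The action takes [f] to [h], up to equality of objects: [unary S (m + n)] and
    [unary S m ⊕ unary S n] are equal but not convertible. Both [f] and [h] are
    built with the operations of a rig category, so the lemmas below run in
    parallel in [FSet_sk] and in [S]. *)
Definition sends m n (f : m ~> n) x y (h : x ~> y) := fmap G f ≡ h.

Lemma sends_comp m n p x y z (g : n ~> p) (f : m ~> n) (k : y ~> z)
    (h : x ~> y) :
  sends g k -> sends f h -> sends (g ∘ f) (k ∘ h).
Proof. by rewrite /sends fmap_comp; apply: heq_comp. Qed.

Lemma sends_id m x : unary S m = x -> sends (idm m) (idm x).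
Proof. by rewrite /sends fmap_id => <-; apply: heq_refl. Qed.

Lemma sends_identity m n (f : m ~> n) x y (h : x ~> y) : unary S m = x ->
  is_identity f -> is_identity h -> sends f h.
Proof.
by move=> mx f1 h1; case: _ / f1; case: _ / h1 mx => mx; apply: sends_id.
Qed.

Lemma sends_inv m n (f : iso m n) x y (h : iso x y) :
  sends f h -> sends (isoi f) (isoi h).
Proof. exact: (heq_iso_inv (f := fmap_iso G f)). Qed.

Lemma sends_heq m n m' n' (f : m ~> n) (f' : m' ~> n') x y x' y'
    (h : x ~> y) (h' : x' ~> y') :
  f ≡ f' -> h ≡ h' -> sends f h -> sends f' h'.
Proof. by case; case. Qed.

Lemma sends_objs m m' (f : m ~> m') x x' (h : x ~> x') :
  sends f h -> unary S m = x /\ unary S m' = x'.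
Proof. exact: heq_objs. Qed.

Lemma act_add1r m n p (g : n ~> p) :
  fmap G (idm m ⊞ g) ≡ idm (unary S m) ⊞ fmap G g.
Proof.
elim: m => [|m IH].
  apply: (heq_trans (g := fmap G g)).
    exact: fmap_heq (strict_add0 FSet_sk_left_semistrict g).
  exact: heq_sym (strict_add0 hS _).
have e : idm (m.+1 : FSet_sk) = idm r1 ⊞ idm (m : FSet_sk) by rewrite raddm_id.
apply: (heq_trans (g := fmap G (idm r1 ⊞ (idm (m : FSet_sk) ⊞ g)))).
  rewrite e; apply: fmap_heq (heq_sym _).
  exact: (strict_addA FSet_sk_left_semistrict).
apply: heq_trans (heq_of_eq (act_fin1 _ _)) _.
apply: heq_trans (raddm_heq (heq_refl (idm r1)) IH) _.
by apply: heq_trans (strict_addA hS _ _ _) _; rewrite raddm_id; apply: heq_refl.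
Qed.

Lemma act_add1l m n p (f : m ~> n) :
  fmap G (f ⊞ idm p) ≡ fmap G f ⊞ idm (unary S p).
Proof.
elim/perm_ind: f => {m n} [m|m n q g f IHg IHf|m n f IH|n].
- have -> : finbij_id m = idm (m : FSet_sk) by [].
  rewrite raddm_id !fmap_id raddm_id; apply: heq_id.
  exact: unary_add.
- have -> : finbij_comp g f = @compm FSet_sk _ _ _ g f by [].
  rewrite -[idm p]comp1m raddm_comp !fmap_comp -[idm (unary _ _)]comp1m.
  by rewrite raddm_comp; apply: heq_comp.
- have := strict_addA FSet_sk_left_semistrict (idm r1)
    (f : (m : FSet_sk) ~> n) (idm p).
  move/heq_sym/(fmap_heq G)/heq_trans; apply.
  apply: heq_trans (heq_of_eq (act_fin1 _ _)) _.
  apply: heq_trans (raddm_heq (heq_refl (idm r1)) IH) _.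
  apply: heq_trans (strict_addA hS _ _ _) _.
  by apply: raddm_heq; [apply/heq_sym/heq_of_eq/act_fin1|apply: heq_refl].
- have := strict_swap_add FSet_sk_left_semistrict r1 r1 n p.
  move/(fmap_heq G)/heq_trans; apply.
  apply: heq_trans (heq_of_eq (act_swap S (n + p))) _.
  have e : swap r1 r1 (unary S (n + p)) ≡ swap r1 r1 (unary S n ⊕ unary S p).
    by rewrite -unary_add //; apply: heq_refl.
  apply: heq_trans e _.
  apply: heq_trans (heq_sym (strict_swap_add hS _ _ _ _)) _.
  by apply: raddm_heq; [apply/heq_sym/heq_of_eq/act_swap|apply: heq_refl].
Qed.

Lemma sends_add1r m m' (f : m ~> m') x x' (h : x ~> x') n z :
  unary S n = z -> sends f h -> sends (idm n ⊞ f) (idm z ⊞ h).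
Proof.
move=> <- fh; apply: heq_trans (act_add1r _ _) _.
exact: raddm_heq (heq_refl _) fh.
Qed.

Lemma sends_add1l m m' (f : m ~> m') x x' (h : x ~> x') n z :
  unary S n = z -> sends f h -> sends (f ⊞ idm n) (h ⊞ idm z).
Proof.
move=> <- fh; apply: heq_trans (act_add1l _ _) _.
exact: raddm_heq fh (heq_refl _).
Qed.

Lemma sends_add m m' n n' x x' y y' (f : m ~> m') (g : n ~> n')
    (h : x ~> x') (k : y ~> y') :
  sends f h -> sends g k -> sends (f ⊞ g) (h ⊞ k).
Proof.
move=> fh gk; rewrite (raddm_split f) (raddm_split h).
apply: sends_comp; last by apply: sends_add1r (gk); have [] := sends_objs fh.
by apply: sends_add1l (fh); have [] := sends_objs gk.
Qed.

Lemma unary_radd m n x y : unary S m = x -> unary S n = y ->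
  unary S (m ⊕ n) = x ⊕ y.
Proof. by move=> <- <-; apply: unary_add. Qed.

Lemma unary_rmul m n x y : unary S m = x -> unary S n = y ->
  unary S (m ⊗ n) = x ⊗ y.
Proof. by move=> <- <-; apply: unary_mul. Qed.

Lemma sends_a m n p x y z :
  unary S m = x -> unary S n = y -> unary S p = z ->
  sends (a_ m n p) (a_ x y z).
Proof.
move=> mx ny pz; apply: sends_identity (strict_a hS _ _ _).
  by do 2![apply: unary_radd => //].
exact: strict_a FSet_sk_left_semistrict _ _ _.
Qed.

Lemma sends_c_sym m n x y : sends (c_ m n) (c_ x y) -> sends (c_ n m) (c_ y x).
Proof. by move/sends_inv; rewrite !c_inv. Qed.

(** The hexagon, in [FSet_sk] and in [S]. *)
Lemma sends_c_addl m n p x y z :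
  unary S m = x -> unary S n = y -> unary S p = z ->
  sends (c_ m p) (c_ x z) -> sends (c_ n p) (c_ y z) ->
  sends (c_ (m ⊕ n) p) (c_ (x ⊕ y) z).
Proof.
move=> mx ny pz cm cn; apply: sends_heq (strict_c_addl _ _ _ _) _ _.
- exact: FSet_sk_left_semistrict.
- exact: strict_c_addl hS _ _ _.
- apply: sends_comp (sends_comp _ (sends_a _ _ _)) _ => //.
    by apply: sends_add => //; apply: sends_id.
  by apply: sends_add => //; apply: sends_id.
Qed.

(** The swap of the first two elements, with nothing after them. *)
Lemma sends_c11 : sends (c_ r1 r1) (c_ r1 r1).
Proof.
have hF := FSet_sk_left_semistrict.
apply: sends_heq (heq_of_eq (act_swap S 0)); last first.
  exact: heq_trans (strict_swap hS _ _ _) (strict_addn0 hS _).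
exact: heq_trans (strict_swap hF r1 r1 r0) (strict_addn0 hF _).
Qed.

Lemma sends_c m n x y : unary S m = x -> unary S n = y ->
  sends (c_ m n) (c_ x y).
Proof.
move=> <- <- {x y}.
have c0 (k : FSet_sk) y : unary S k = y -> sends (c_ r0 k) (c_ r0 y).
  move=> ky; apply: sends_identity; first exact: unary_radd.
    exact: is_identity_c0 FSet_sk_left_semistrict _.
  exact: is_identity_c0 hS _.
have c1 (k : FSet_sk) : sends (c_ k r1) (c_ (unary S k) r1).
  elim: k => [|k IH]; first exact/c0/unary1.
  apply: (@sends_c_addl r1 k r1 r1 (unary S k) r1) => //; try exact: unary1.
  exact: sends_c11.
elim: m => [|m IH]; first exact: c0.
apply: (@sends_c_addl r1 m n r1 (unary S m) (unary S n)) => //.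
  exact: unary1.
exact: sends_c_sym.
Qed.

Lemma sends_mul1r m n p (g : n ~> p) :
  sends (idm m ⊠ g) (idm (unary S m) ⊠ fmap G g).
Proof.
have hF := FSet_sk_left_semistrict.
elim/perm_ind: g => {n p} [n|n p q g f IHg IHf|n p f IH|n].
- have -> : finbij_id n = idm (n : FSet_sk) by [].
  by rewrite fmap_id !rmulm_id; apply/sends_id/unary_mul.
- have -> : finbij_comp g f = @compm FSet_sk _ _ _ g f by [].
  rewrite -[idm m]comp1m rmulm_comp fmap_comp -[idm (unary _ _)]comp1m.
  by rewrite rmulm_comp; apply: sends_comp.
- apply: sends_heq (heq_sym (strict_mulDr hF (idm m) (idm r1) f)) _ _.
    rewrite [fmap G _]act_fin1; apply: heq_sym (strict_mulDr hS _ _ _).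
  apply: sends_add => //; rewrite !rmulm_id; apply: sends_id.
  by apply: unary_rmul => //; apply: unary1.
- rewrite [fmap G _]act_swap.
  have fS := heq_sym (strict_mul_swap hF m r1 r1 (n : FSet_sk)).
  have gS := heq_sym (strict_mul_swap hS (unary S m) r1 r1 (unary S n)).
  apply: (sends_heq fS gS); apply: sends_add.
    by apply: sends_c; apply: unary_rmul => //; apply: unary1.
  exact/sends_id/unary_mul.
Qed.

Lemma sends_mul1l m n p (f : m ~> n) :
  sends (f ⊠ idm p) (fmap G f ⊠ idm (unary S p)).
Proof.
have hF := FSet_sk_left_semistrict.
elim: p => [|p IH].
  have f0 := heq_sym (strict_muln0 hF f).
  have g0 := heq_sym (strict_muln0 hS (fmap G f)).
  by apply: (sends_heq f0 g0); apply: sends_id.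
have fS := heq_sym (strict_mulDr hF f (idm r1) (idm (p : FSet_sk))).
have gS := heq_sym (strict_mulDr hS (fmap G f) (idm r1) (idm (unary S p))).
rewrite raddm_id in fS; rewrite raddm_id in gS.
apply: (sends_heq fS gS).
apply: sends_add => //.
apply: sends_heq (heq_sym (strict_muln1 hF f))
  (heq_sym (strict_muln1 hS (fmap G f))) _.
exact: heq_refl.
Qed.

Lemma sends_mul m m' n n' (f : m ~> m') (g : n ~> n') :
  sends (f ⊠ g) (fmap G f ⊠ fmap G g).
Proof.
rewrite rmulm_split [fmap G f ⊠ _]rmulm_split.
exact: sends_comp (sends_mul1l _ _) (sends_mul1r _ _).
Qed.

Lemma sends_d m n p x y z :
  unary S m = x -> unary S n = y -> unary S p = z ->
  sends (d_ m n p) (d_ x y z).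
Proof.
move=> mx ny pz; apply: sends_identity (strict_d hS _ _ _).
  by apply: unary_rmul => //; apply: unary_radd.
exact: strict_d FSet_sk_left_semistrict _ _ _.
Qed.

Lemma sends_v m n p q x y z w :
  unary S m = x -> unary S n = y -> unary S p = z -> unary S q = w ->
  sends (v_iso m n p q) (v_iso x y z w).
Proof.
move=> mx ny pz qw; rewrite /v_iso.
do 4?[apply: sends_comp].
- by apply: sends_a => //; apply: unary_radd.
- by apply: sends_add; [apply: sends_id|apply: sends_inv; apply: sends_a].
- apply: sends_add; first exact: sends_id.
  by apply: sends_add; [apply: sends_c|apply: sends_id].
- by apply: sends_add; [apply: sends_id|apply: sends_a].
- by apply: sends_inv; apply: sends_a => //; apply: unary_radd.
Qed.

(** By induction on the last argument: the right distributor is an identity for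
    [r0] and for [r1], and [d'_addr] handles sums. *)
Lemma sends_d' m n p x y z :
  unary S m = x -> unary S n = y -> unary S p = z ->
  sends (d'_ m n p) (d'_ x y z).
Proof.
move=> <- <- <-.
have hF := FSet_sk_left_semistrict.
elim: p => [|p IH].
  apply: sends_identity (is_identity_d'0 hF _ _) (is_identity_d'0 hS _ _).
  by apply: unary_rmul => //; apply: unary_radd.
have u1 := unary1 hS.
have -> : d'_ m n (p.+1 : FSet_sk) = d'_ m n (r1 ⊕ (p : FSet_sk)) by [].
rewrite [unary S p.+1]/(r1 ⊕ unary S p) (d'_addr (unary S m)).
rewrite (d'_addr (S := FSet_sk) m n r1 p).
apply: sends_comp; last apply: sends_comp; last apply: sends_comp.
- apply: sends_inv; apply: sends_add.
  + exact: (@sends_d m r1 p).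
  + exact: (@sends_d n r1 p).
- apply: (@sends_inv _ _ (v_iso (m ⊗ r1) (m ⊗ p) (n ⊗ r1) (n ⊗ p))).
  by apply: sends_v; apply: unary_rmul.
- apply: sends_add => //.
  apply: sends_identity (is_identity_d'1 hF _ _) (is_identity_d'1 hS _ _).
  by apply: unary_rmul => //; apply: unary_radd.
- by apply: (@sends_d (m ⊕ n) r1 p) => //; apply: unary_radd.
Qed.

End StrictAction.

Section StrictHom.
Variables (S : rigcat) (hS : left_semistrict S).

#[local] Hint Resolve is_identity_comp raddm_identity rmulm_identity
  is_identity_id fmap_identity eq_iso_identity : identity.
#[local] Hint Resolve strict_a strict_l strict_r strict_a' strict_l' strict_r'
  strict_d strict_n strict_n' FSet_sk_left_semistrict : identity.

(** All coherence morphisms are identities. So are both sides of every law that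
    does not involve [⊞] or [⊠] of arbitrary morphisms, [c_] or [d'_]. *)
Definition act_hom : rig_hom FSet_sk S.
Proof.
refine (@RigHom FSet_sk S (act_functor S)
    (fun m n => eq_iso (unary_add hS m n)) (eq_iso (erefl _))
    (fun m n => eq_iso (unary_mul hS m n)) (eq_iso (unary1 hS))
    _ _ _ _ _ _ _ _ _ _ _ _ _).
all: intros.
all: try by apply: is_identity_eq;
  do 4?[apply: is_identity_comp | apply: raddm_identity
       | apply: rmulm_identity | apply: fmap_identity];
  eauto with identity.
- apply: nat_heq; try exact: eq_iso_identity.
  by apply: (sends_add hS); apply: heq_refl.
- by apply: nat_heq; try exact: eq_iso_identity; apply: (sends_c hS).
- apply: nat_heq; try exact: eq_iso_identity.
  exact: (sends_mul hS).
- rewrite -(compmA (d'_ _ _ _)); apply: nat_heq.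
  + by apply: is_identity_comp; eauto with identity.
  + by apply: is_identity_comp; eauto with identity.
  + by apply: (sends_d' hS).
Defined.

End StrictHom.

(** * Comparing two homomorphisms *)

(** The conditions on a rig transformation, one morphism or one pair of objects
    at a time, so that each of them can be propagated from smaller objects. *)

Section Families.
Variables (S T : rigcat) (F G : rig_hom S T) (t : forall x : S, F x ~> G x).
Implicit Types x y z : S.

Definition natural_at x y (f : x ~> y) : Prop :=
  t y ∘ fmap F f = fmap G f ∘ t x.

Definition additive_at x y : Prop :=
  rh_add G x y ∘ t (x ⊕ y) = (t x ⊞ t y) ∘ rh_add F x y.

Definition multiplicative_at x y : Prop :=
  rh_mul G x y ∘ t (x ⊗ y) = (t x ⊠ t y) ∘ rh_mul F x y.

Lemma natural_id x : natural_at (idm x).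
Proof. by rewrite /natural_at !fmap_id comp1m compm1. Qed.

Lemma natural_comp x y z (g : y ~> z) (f : x ~> y) :
  natural_at g -> natural_at f -> natural_at (g ∘ f).
Proof.
by rewrite /natural_at !fmap_comp => ng nf; rewrite compmA ng -compmA nf compmA.
Qed.

Lemma natural_inv x y (f : iso x y) : natural_at f -> natural_at (isoi f).
Proof.
move=> nf; apply: (iso_monic (f := fmap_iso G f)).
by rewrite compmA /= -nf -compmA -fmap_comp compmA -fmap_comp !(isoKi, fmap_id)
  comp1m compm1.
Qed.

Lemma natural_identity x y (f : x ~> y) : is_identity f -> natural_at f.
Proof. by case; apply: natural_id. Qed.

Lemma natural_add x x' y y' (f : x ~> x') (g : y ~> y') :
  additive_at x y -> additive_at x' y' ->
  natural_at f -> natural_at g -> natural_at (f ⊞ g).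
Proof.
move=> axy axy' nf ng; apply: (iso_monic (f := rh_add G x' y')).
rewrite !compmA axy' rh_add_nat -!compmA axy rh_add_nat !compmA.
by rewrite -!raddm_comp nf ng.
Qed.

Lemma natural_c x y :
  additive_at x y -> additive_at y x -> natural_at (c_ x y).
Proof.
move=> axy ayx; apply: (iso_monic (f := rh_add G y x)).
by rewrite !compmA ayx rh_add_c -!compmA axy rh_add_c !compmA c_nat.
Qed.

Lemma additive_0l x : rh_zero G ∘ t r0 = rh_zero F ->
  natural_at (l_ x) -> additive_at r0 x.
Proof.
move=> t0 nl.
apply: (iso_monic (f := iso_comp (l_ (G x)) (radd_iso (rh_zero G) (iso_id _)))).
rewrite /= compmA rh_add_l -nl compmA -(compmA (l_ _)) -raddm_comp t0 comp1m.
by rewrite -rh_add_l !compmA -l_nat -(compmA (l_ _)) -raddm_comp comp1m compm1.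
Qed.

Lemma additive_addl x y z : natural_at (a_ x y z) ->
  additive_at x y -> additive_at y z -> additive_at x (y ⊕ z) ->
  additive_at (x ⊕ y) z.
Proof.
move=> na axy ayz axyz.
apply: (iso_monic (f := radd_iso (rh_add G x y) (iso_id (G z)))) => /=.
apply: (iso_epic (f := fmap_iso F (a_ x y z))) => /=.
rewrite -!compmA na !compmA rh_add_a -!compmA axyz 2!(compmA (_ ⊞ _)).
rewrite -!raddm_comp.
rewrite ayz axy !comp1m -[in LHS](compm1 (t x)).
rewrite -[t z in RHS]compm1 !raddm_comp -[in RHS]compmA.
by rewrite (compmA (_ ⊞ idm _)) rh_add_a !compmA a_nat.
Qed.

Lemma multiplicative_0r x : rh_zero G ∘ t r0 = rh_zero F ->
  natural_at (n_ x) -> multiplicative_at x r0.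
Proof.
move=> t0 nn.
apply: (iso_monic (f := iso_comp (n_ (G x)) (rmul_iso (iso_id _) (rh_zero G)))).
rewrite /= compmA -rh_n -compmA -nn compmA t0 rh_n.
rewrite [in RHS]compmA -[in RHS](compmA (n_ _)).
rewrite -rmulm_comp t0 comp1m -(rig_n_nat (rigcat_axioms T) (t x)).
by rewrite -(compmA (n_ _)) -rmulm_comp comp1m compm1.
Qed.

Lemma multiplicative_1r x : rh_one G ∘ t r1 = rh_one F ->
  natural_at (r'_ x) -> multiplicative_at x r1.
Proof.
move=> t1 nr.
apply: (iso_monic (f := iso_comp (r'_ (G x)) (rmul_iso (iso_id _) (rh_one G)))).
rewrite /= compmA rh_mul_r -nr compmA -(compmA (r'_ _)) -rmulm_comp t1 comp1m.
rewrite -rh_mul_r !compmA -r'_nat -(compmA (r'_ _)) -rmulm_comp.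
by rewrite comp1m compm1.
Qed.

Lemma multiplicative_addr x y z : natural_at (d_ x y z) ->
  additive_at y z -> additive_at (x ⊗ y) (x ⊗ z) ->
  multiplicative_at x y -> multiplicative_at x z ->
  multiplicative_at x (y ⊕ z).
Proof.
move=> nd ayz axyz mxy mxz.
apply: (iso_monic (f := iso_comp (d_ (G x) (G y) (G z))
  (rmul_iso (iso_id (G x)) (rh_add G y z)))).
rewrite /= compmA -rh_d -compmA -nd !compmA -(compmA _ _ (t _)) axyz !compmA.
rewrite -raddm_comp mxy mxz raddm_comp.
rewrite -!compmA (compmA (rh_mul F x y ⊞ _)) rh_d !compmA.
rewrite -(compmA (d_ (G x) _ _)) -rmulm_comp ayz comp1m.
rewrite -[t x in RHS]compm1 rmulm_comp !compmA.
by rewrite (rig_d_nat (rigcat_axioms T)).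
Qed.

End Families.

Section Compare.
Variables (T : rigcat) (F G : rig_hom FSet_sk T).
Implicit Types m n p : FSet_sk.

Let hF := FSet_sk_left_semistrict.
Let u : iso (F r1) (G r1) := iso_comp (iso_inv (rh_one G)) (rh_one F).

(** The recursion that compatibility with [r1 ⊕ n] forces on the components of a
    transformation from [F] to [G]. *)
Fixpoint compare_iso (n : nat) : iso (F n) (G n) :=
  match n return iso (F n) (G n) with
  | 0 => iso_comp (iso_inv (rh_zero G)) (rh_zero F)
  | n.+1 => iso_comp (iso_inv (rh_add G r1 (n : FSet_sk)))
              (iso_comp (radd_iso u (compare_iso n))
                (rh_add F r1 (n : FSet_sk)))
  end.

Let t n : F n ~> G n := compare_iso n.

Lemma compare_zero : rh_zero G ∘ t r0 = rh_zero F.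
Proof. exact: compKVm. Qed.

Lemma compare_addr n :
  rh_add G r1 n ∘ t (r1 ⊕ n) = (u ⊞ t n) ∘ rh_add F r1 n.
Proof. exact: compKVm. Qed.

(** The recursion defines the component at [r1] by way of [r1 ⊕ r0]; the right
    unit brings it back to [u]. *)
Lemma compare_r1 : t r1 = u.
Proof.
apply: (iso_epic (f := fmap_iso F (@r_ FSet_sk r1))).
apply: etrans (natural_identity t (strict_r hF r1)) _.
rewrite fmap_isoE -(rh_add_r G r1) -(compmA _ _ (t _)) compare_addr.
rewrite !compmA -(compmA (r_ _)) -raddm_comp compare_zero comp1m.
rewrite (raddm_split u) compmA r_nat -!compmA (compmA (r_ _)).
by rewrite (rh_add_r F r1).
Qed.

Lemma compare_one : rh_one G ∘ t r1 = rh_one F.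
Proof. by rewrite compare_r1 compKVm. Qed.

Lemma compare_add m n : additive_at t m n.
Proof.
elim: m => [|m IH].
  exact: additive_0l compare_zero (natural_identity t (strict_l hF n)).
apply: (additive_addl (x := r1 : FSet_sk) (y := m)) => //.
- exact: natural_identity (strict_a hF _ _ _).
- by rewrite /additive_at compare_addr compare_r1.
- by rewrite /additive_at compare_addr compare_r1.
Qed.

Lemma compare_nat m n (f : m ~> n) : natural_at t f.
Proof.
elim/perm_ind: f => {m n} [m|m n p g f ng nf|m n f nf|n].
- exact: natural_id.
- exact: natural_comp.
- apply: (natural_add (x := r1 : FSet_sk) (x' := r1)) => //;
    by [apply: compare_add|apply: natural_id].
- rewrite /fswap swapE; apply: natural_comp; first apply: natural_comp.
  + apply: natural_inv; apply: natural_identity.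
    exact: (strict_a hF r1 r1 (n : FSet_sk)).
  + apply: natural_add; try exact: compare_add; last exact: natural_id.
    by apply: natural_c; apply: compare_add.
  + apply: natural_identity.
    exact: (strict_a hF r1 r1 (n : FSet_sk)).
Qed.

Lemma compare_mul m n : multiplicative_at t m n.
Proof.
elim: n => [|n IH].
  exact: multiplicative_0r compare_zero (compare_nat _).
apply: (multiplicative_addr (y := r1 : FSet_sk) (z := n)) => //.
- exact: compare_nat.
- exact: compare_add.
- exact: compare_add.
- exact: multiplicative_1r compare_one (compare_nat _).
Qed.

Definition compare : rig_trans F G :=
  @RigTrans _ _ F G t compare_nat compare_add compare_zero compare_mul
    compare_one.

Lemma rig_trans_unique (s s' : rig_trans F G) : s = s'.
Proof.
apply: rig_trans_eq; elim=> [|n IH].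
  by apply: (iso_monic (f := rh_zero G)); rewrite (rt_zero s) (rt_zero s').
apply: (iso_monic (f := rh_add G r1 (n : FSet_sk))).
rewrite (rt_add s r1 (n : FSet_sk)) (rt_add s' r1 (n : FSet_sk)) IH.
congr ((_ ⊞ _) ∘ _).
by apply: (iso_monic (f := rh_one G)); rewrite (rt_one s) (rt_one s').
Qed.

Lemma compare_isoE (s : rig_trans F G) n : compare_iso n = s n :> (_ ~> _).
Proof. by rewrite (rig_trans_unique s compare). Qed.

End Compare.

(** * Transport of homomorphisms *)

(** A functor with the data of a homomorphism is one as soon as these data
    correspond to those of a homomorphism [F] under an isomorphism [t]: composing
    a law for [X] with [t] turns it into the same law for [F]. *)
Section Transport.
Variables (S T : rigcat) (F : rig_hom S T) (X : functor S T).
Variable t : forall x, iso (X x) (F x).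
Variables (add : forall x y, iso (X (x ⊕ y)) (X x ⊕ X y)) (zero : iso (X r0) r0).
Variables (mul : forall x y, iso (X (x ⊗ y)) (X x ⊗ X y)) (one : iso (X r1) r1).
Hypothesis t_nat : forall x y (f : x ~> y), t y ∘ fmap X f = fmap F f ∘ t x.
Hypothesis t_add : forall x y,
  (t x ⊞ t y) ∘ add x y = rh_add F x y ∘ t (x ⊕ y).
Hypothesis t_zero : isof zero = rh_zero F ∘ t r0.
Hypothesis t_mul : forall x y,
  (t x ⊠ t y) ∘ mul x y = rh_mul F x y ∘ t (x ⊗ y).
Hypothesis t_one : isof one = rh_one F ∘ t r1.
Implicit Types x y z : S.

Definition transport_hom : rig_hom S T.
Proof.
refine (@RigHom S T X add zero mul one _ _ _ _ _ _ _ _ _ _ _ _ _).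
- move=> x x' y y' f g; apply: (iso_monic (f := radd_iso (t x') (t y'))).
  rewrite radd_isoE !compmA t_add -!compmA t_nat !compmA -raddm_comp !t_nat.
  by rewrite raddm_comp -!compmA t_add !compmA rh_add_nat.
- move=> x y z.
  apply: (iso_monic (f := radd_iso (radd_iso (t x) (t y)) (t z))).
  rewrite !radd_isoE !compmA -a_nat -raddm_comp t_add compm1.
  rewrite raddm_compl -(compmA _ _ (add _ _)) t_add.
  rewrite -!compmA t_nat (compmA (_ ⊞ _) (_ ⊞ _)) -raddm_comp t_add compm1.
  by rewrite raddm_compr -!compmA t_add !compmA rh_add_a.
- move=> x; apply: (iso_monic (f := t x)).
  rewrite t_nat -(rh_add_l F x) !compmA -l_nat t_zero.
  rewrite -(compmA (l_ _)) -raddm_comp comp1m compm1.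
  by rewrite raddm_compl -!compmA t_add.
- move=> x; apply: (iso_monic (f := t x)).
  rewrite t_nat -(rh_add_r F x) !compmA -r_nat t_zero.
  rewrite -(compmA (r_ _)) -raddm_comp comp1m compm1.
  by rewrite raddm_compr -!compmA t_add.
- move=> x y; apply: (iso_monic (f := radd_iso (t y) (t x))).
  rewrite radd_isoE !compmA t_add -c_nat -!compmA t_nat t_add !compmA.
  by rewrite rh_add_c.
- move=> x x' y y' f g; apply: (iso_monic (f := rmul_iso (t x') (t y'))).
  rewrite rmul_isoE !compmA t_mul -!compmA t_nat !compmA -rmulm_comp !t_nat.
  by rewrite rmulm_comp -!compmA t_mul !compmA rh_mul_nat.
- move=> x y z.
  apply: (iso_monic (f := rmul_iso (rmul_iso (t x) (t y)) (t z))).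
  rewrite !rmul_isoE !compmA -a'_nat -rmulm_comp t_mul compm1.
  rewrite rmulm_compl -(compmA _ _ (mul _ _)) t_mul.
  rewrite -!compmA t_nat (compmA (_ ⊠ _) (_ ⊠ _)) -rmulm_comp t_mul compm1.
  by rewrite rmulm_compr -!compmA t_mul !compmA rh_mul_a.
- move=> x; apply: (iso_monic (f := t x)).
  rewrite t_nat -(rh_mul_l F x) !compmA -l'_nat t_one.
  rewrite -(compmA (l'_ _)) -rmulm_comp comp1m compm1.
  by rewrite rmulm_compl -!compmA t_mul.
- move=> x; apply: (iso_monic (f := t x)).
  rewrite t_nat -(rh_mul_r F x) !compmA -r'_nat t_one.
  rewrite -(compmA (r'_ _)) -rmulm_comp comp1m compm1.
  by rewrite rmulm_compr -!compmA t_mul.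
- move=> x y z; apply: (iso_monic (f := radd_iso (rmul_iso (t x) (t y))
    (rmul_iso (t x) (t z)))).
  rewrite radd_isoE !rmul_isoE !compmA -(rig_d_nat (rigcat_axioms T)).
  rewrite -raddm_comp !t_mul raddm_comp -(compmA _ _ (add _ _)) t_add.
  rewrite -!compmA t_nat (compmA (_ ⊠ _) (_ ⊠ _)) -rmulm_comp t_add compm1.
  by rewrite rmulm_compr -!compmA t_mul !compmA rh_d.
- move=> x y z; apply: (iso_monic (f := radd_iso (rmul_iso (t y) (t x))
    (rmul_iso (t z) (t x)))).
  rewrite radd_isoE !rmul_isoE !compmA -(rig_d'_nat (rigcat_axioms T)).
  rewrite -raddm_comp !t_mul raddm_comp -(compmA _ _ (add _ _)) t_add.
  rewrite -!compmA t_nat (compmA (_ ⊠ _) (_ ⊠ _)) -rmulm_comp t_add compm1.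
  by rewrite rmulm_compl -!compmA t_mul !compmA rh_d'.
- move=> x; rewrite t_zero -compmA t_nat compmA rh_n -!compmA -t_mul.
  rewrite (compmA (_ ⊠ _)) -rmulm_comp comp1m.
  rewrite -(rig_n_nat (rigcat_axioms T) (t x)).
  by rewrite -!compmA (compmA (_ ⊠ _)) -rmulm_comp compm1 comp1m.
- move=> x; rewrite t_zero -compmA t_nat compmA rh_n' -!compmA -t_mul.
  rewrite (compmA (_ ⊠ _)) -rmulm_comp comp1m.
  rewrite -(rig_n'_nat (rigcat_axioms T) (t x)).
  by rewrite -!compmA (compmA (_ ⊠ _)) -rmulm_comp compm1 comp1m.
Defined.

End Transport.

Section TransportAlong.
Variables (S T : rigcat) (F : rig_hom S T) (X : S -> T).
Variable t : forall x, iso (X x) (F x).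

Definition transport_functor : functor S T.
Proof.
refine (@Functor S T X (fun x y f => isoi (t y) ∘ (fmap F f ∘ t x)) _ _).
- by move=> x; rewrite fmap_id comp1m isoK.
- by move=> x y z g f; rewrite fmap_comp -!compmA compKVm.
Defined.

Lemma transport_nat x y (f : x ~> y) :
  t y ∘ fmap transport_functor f = fmap F f ∘ t x.
Proof. exact: compKVm. Qed.

Definition transport : rig_hom S T.
Proof.
refine (@transport_hom S T F transport_functor t
  (fun x y => iso_comp (iso_inv (radd_iso (t x) (t y)))
                (iso_comp (rh_add F x y) (t (x ⊕ y))))
  (iso_comp (rh_zero F) (t r0))
  (fun x y => iso_comp (iso_inv (rmul_iso (t x) (t y)))
                (iso_comp (rh_mul F x y) (t (x ⊗ y))))
  (iso_comp (rh_one F) (t r1)) transport_nat _ _ _ _) => //.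
- by move=> x y; apply: (compKVm (radd_iso (t x) (t y))).
- by move=> x y; apply: (compKVm (rmul_iso (t x) (t y))).
Defined.

Definition transport_trans : rig_trans transport F.
Proof.
refine (@RigTrans S T transport F t transport_nat _ _ _ _) => //.
- by move=> x y; apply: esym; apply: (compKVm (radd_iso (t x) (t y))).
- by move=> x y; apply: esym; apply: (compKVm (rmul_iso (t x) (t y))).
Defined.

End TransportAlong.

(** Each datum of [G] is read off from the corresponding datum of [F] by one of
    the conditions on [s], once the objects have been identified. *)
Lemma rig_hom_eq (S T : rigcat) (F G : rig_hom S T) (s : rig_trans F G) :
  (forall x, is_identity (s x)) -> F = G.
Proof.
case: F G s => [[Fo Fm Fi Fc] Fa Fz Fx F1 ? ? ? ? ? ? ? ? ? ? ? ? ?].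
case=> [[Go Gm Gi Gc] Ga Gz Gx G1 ? ? ? ? ? ? ? ? ? ? ? ? ?] /=.
case=> s /= snat sadd szero smul sone s1.
have e : Fo = Go by apply/funext => x; apply: is_identity_obj (s1 x).
subst Go.
have sE x : s x = idm (Fo x) by apply: is_identity_eq.
have e : Fm = Gm.
  apply: functional_extensionality_dep => x.
  apply: functional_extensionality_dep => y; apply/funext => f.
  by have := snat _ _ f; rewrite !sE comp1m compm1.
subst Gm.
have e : Gi = Fi by apply: Prop_irrelevance.
subst Gi; have e : Gc = Fc by apply: Prop_irrelevance.
subst Gc; have e : Ga = Fa.
  apply: functional_extensionality_dep => x.
  apply: functional_extensionality_dep => y; apply: iso_eq.
  by have := sadd x y; rewrite !sE raddm_id comp1m compm1.
subst Ga; have e : Gx = Fx.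
  apply: functional_extensionality_dep => x.
  apply: functional_extensionality_dep => y; apply: iso_eq.
  by have := smul x y; rewrite !sE rmulm_id comp1m compm1.
subst Gx; have e : Gz = Fz by apply: iso_eq; rewrite -szero sE compm1.
subst Gz; have e : G1 = F1 by apply: iso_eq; rewrite -sone sE compm1.
by subst G1; congr RigHom; apply: Prop_irrelevance.
Qed.

Definition rig_trans_inv (S T : rigcat) (F G : rig_hom S T)
    (t : forall x : S, iso (F x) (G x)) (s : rig_trans F G)
    (ts : forall x, isof (t x) = s x) : rig_trans G F.
Proof.
refine (@RigTrans S T G F (fun x => isoi (t x)) _ _ _ _ _).
- move=> x y f; apply: (iso_monic (f := t y)).
  by rewrite compKVm compmA [in RHS]ts rt_nat -ts compmK.
- move=> x y; apply: (iso_monic (f := radd_iso (t x) (t y))).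
  rewrite [RHS](compKVm (radd_iso (t x) (t y))).
  apply: (iso_epic (f := t (x ⊕ y))).
  by rewrite /= compmA compmKV [in RHS]ts rt_add !ts.
- by apply: (iso_epic (f := t r0)); rewrite compmKV ts rt_zero.
- move=> x y; apply: (iso_monic (f := rmul_iso (t x) (t y))).
  rewrite [RHS](compKVm (rmul_iso (t x) (t y))).
  apply: (iso_epic (f := t (x ⊗ y))).
  by rewrite /= compmA compmKV [in RHS]ts rt_mul !ts.
- by apply: (iso_epic (f := t r1)); rewrite compmKV ts rt_one.
Defined.

(** * Classifying the homomorphisms *)

Lemma nfold_unary (S : rigcat) (hS : left_semistrict S) n :
  nfold S n = unary S n.
Proof.
case: n => // n; elim: n => [|n IH]; first by rewrite unary1.
by have := unary_add hS n.+1 1; rewrite addn1 unary1 // -IH => ->.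
Qed.

Lemma functor_eq_thin (C D : category) (F G : functor C D) :
  (forall (x y : D) (f g : x ~> y), f = g) -> fobj F = fobj G -> F = G.
Proof.
move=> thin; case: F G => [Fo Fm Fi Fc] [Go Gm Gi Gc] /= e; subst Go.
have e : Fm = Gm.
  apply: functional_extensionality_dep => x.
  by apply: functional_extensionality_dep => y; apply/funext => f; apply: thin.
by subst Gm; congr Functor; apply: Prop_irrelevance.
Qed.

Section Classification.
Variables (S : rigcat) (H : rig_hom FSet_sk S).
Variable e : forall n, iso (H n) (nfold S n).

Definition frame (F : rig_hom FSet_sk S) : framed_sequence S :=
  let t n := iso_comp (e n) (compare_iso F H n) in
  FramedSequence (fun n => inhabits (t n)) t.

Definition unframe (x : framed_sequence S) : rig_hom FSet_sk S :=
  transport (F := H) (X := fs_obj x)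
    (fun n => iso_comp (iso_inv (e n)) (fs_tau x n)).

Lemma framed_sequence_eq (o : nat -> S) i i'
    (t t' : forall n, iso (o n) (nfold S n)) :
  (forall n, isof (t n) = t' n) ->
  FramedSequence i t = FramedSequence i' t'.
Proof.
move=> tt'; have et : t = t'.
  by apply: functional_extensionality_dep => n; apply: iso_eq.
by subst t'; congr FramedSequence; apply: Prop_irrelevance.
Qed.

(** The isomorphisms of [x] form a transformation from [unframe x] to [H], up to
    [e], so by uniqueness they are the components of [compare]. *)
Lemma unframeK : cancel unframe frame.
Proof.
case=> o i t; apply: framed_sequence_eq => n.
pose t' n := iso_comp (iso_inv (e n)) (t n).
have -> : compare_iso (unframe (FramedSequence i t)) H n = t' n.
  exact/iso_eq/(compare_isoE (transport_trans (F := H) t')).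
exact: compKVm.
Qed.

(** [F] and [unframe (frame F)] are transformed into [H] by the same components,
    so going forth and back is a transformation between the two with identity
    components. *)
Lemma frameK : cancel frame unframe.
Proof.
move=> F; set t := fun n => iso_comp (iso_inv (e n)) (fs_tau (frame F) n).
pose s := rig_trans_inv (s := transport_trans (F := H) t) (fun=> erefl).
apply: esym; apply: (rig_hom_eq (s := rig_trans_comp s (compare F H))) => n.
have -> : rig_trans_comp s (compare F H) n = isoi (t n) ∘ compare_iso F H n.
  by [].
have -> : isof (compare_iso F H n) = t n by apply: esym; apply: compKm.
by rewrite isoK; apply: is_identity_id.
Qed.

Hypothesis sk : skeletal S.

Lemma fs_obj_nfold (x : framed_sequence S) n : fs_obj x n = nfold S n.
Proof. exact/sk/fs_isomorphic. Qed.

Definition frame_aut (x : framed_sequence S) n : Aut (nfold S n) :=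
  iso_comp (fs_tau x n) (eq_iso (esym (fs_obj_nfold x n))).

Definition aut_frame (t : forall n, Aut (nfold S n)) : framed_sequence S :=
  FramedSequence (fun n => inhabits (t n)) t.

Lemma frame_autK : cancel frame_aut aut_frame.
Proof.
case=> o i t; have eo : o = nfold S.
  by apply/funext => n; apply: fs_obj_nfold (FramedSequence i t) n.
subst o; apply: framed_sequence_eq => n.
by rewrite /= (Prop_irrelevance (esym _) erefl) compm1.
Qed.

Lemma aut_frameK : cancel aut_frame frame_aut.
Proof.
move=> t; apply: functional_extensionality_dep => n; apply: iso_eq.
by rewrite /= (Prop_irrelevance (esym _) erefl) compm1.
Qed.

End Classification.

Lemma isomorphic_contractible (C : category) (X : Type)
    (f : C -> X) (g : X -> C) (h : forall x y : C, x ~> y) :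
  (forall (x y : C) (p q : x ~> y), p = q) -> cancel f g -> cancel g f ->
  isomorphic_categories C (contractible_category X).
Proof.
move=> thin fK gK; pose D := contractible_category X.
exists (@Functor C D f (fun _ _ _ => tt) (fun=> erefl) (fun _ _ _ _ _ => erefl)).
exists (@Functor D C g (fun x y _ => h (g x) (g y)) (fun=> thin _ _ _ _)
  (fun _ _ _ _ _ => thin _ _ _ _)).
split; apply: functor_eq_thin => //=; try by apply/funext.
by move=> x y [] [].
Qed.

Theorem corollary4p4p2 (S : rigcat) (hS : left_semistrict S) :
  (exists f : obj (HomRigCat FSet_sk S) -> framed_sequence S, bijective f) /\
  (skeletal S ->
   isomorphic_categories (HomRigCat FSet_sk S)
     (contractible_category (forall n : nat, Aut (nfold S n)))).
Proof.
pose H := act_hom hS.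
pose e n : iso (H n) (nfold S n) := eq_iso (esym (nfold_unary hS n)).
split=> [|sk].
  by exists (frame e); apply: Bijective (frameK e) (unframeK e).
apply: (isomorphic_contractible (C := HomRigCat FSet_sk S)
  (f := frame_aut sk \o frame e) (g := unframe e \o @aut_frame S)).
- exact: compare.
- exact: rig_trans_unique.
- exact: can_comp (frame_autK sk) (frameK e).
- exact: can_comp (unframeK e) (aut_frameK sk).
Qed.
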